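(* Let $\mathbb F$ be a field of characteristic $p$ (if $p=0$, the constraint involving $p$ is void). Let $L$ be a set of $n\le p^{4/3}$ distinct lines, all belonging to one linear regular line complex, and let $Q$ be a set of $m$ points in $\mathbb F^3$. Then the number of incidences $$|\{(q,l)\in Q\times L:\ q\in l\}|$$ is $O\big(m^{3/4}n^{1/2}+m+n\big)$, where the implied constant is absolute.
   Context: Lines in $\mathbb F^3$ are regarded as lines in projective space $\mathbb P^3$ (over $\mathbb F$ or its algebraic closure). Plücker coordinates: a line through two distinct points $(x_0:x_1:x_2:x_3)$ and $(y_0:y_1:y_2:y_3)$ of $\mathbb P^3$ has Plücker vector $$\boldsymbol P=[P_{01}:P_{02}:P_{03}:P_{23}:P_{31}:P_{12}]\in\mathbb P^5,\qquad P_{ij}=x_iy_j-x_jy_i.$$ Write $\boldsymbol P=[\boldsymbol\omega:\boldsymbol v]$ with $\boldsymbol\omega=(P_{01},P_{02},P_{03})$ and $\boldsymbol v=(P_{23},P_{31},P_{12})$. The Plücker vectors of lines are exactly the points of the Klein quadric $$\mathcal K=\{\boldsymbol\omega\cdot\boldsymbol v=0\}\subset\mathbb P^5,$$ where $\cdot$ is the standard dot product. A linear regular line complex is the set of all lines whose Plücker vectors lie in $\mathcal K\cap\mathcal H$, where $\mathcal H=\{\boldsymbol P:\ \boldsymbol N\cdot\boldsymbol P=0\}$ is a hyperplane in $\mathbb P^5$. The normal vector $\boldsymbol N=[\boldsymbol n:\boldsymbol m]$ is required not to lie in $\mathcal K$, i.e. $\boldsymbol n\cdot\boldsymbol m\neq0$.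 The lines of the complex may be defined over the algebraic closure of $\mathbb F$. *)

(* Defs.v *)
From HB Require Import structures.
From mathcomp Require Import all_boot all_order all_algebra.
From Stdlib Require Reals.
Set Implicit Arguments. Unset Strict Implicit. Unset Printing Implicit Defensive.
Import GRing.Theory.
Local Open Scope ring_scope.

(* A line in F^3 is given by a point a and a nonzero direction d;
   it is the point set a + span(d). *)
Definition on_line (F : fieldType) (l : 'rV[F]_3 * 'rV[F]_3) (q : 'rV[F]_3) : bool :=
  (q - l.1 <= l.2)%MS.

Definition is_line (F : fieldType) (l : 'rV[F]_3 * 'rV[F]_3) : bool := l.2 != 0.

Definition same_line (F : fieldType) (l1 l2 : 'rV[F]_3 * 'rV[F]_3) : Prop :=
  forall q, on_line l1 q = on_line l2 q.

Definition distinct_lines (F : fieldType) (L : seq ('rV[F]_3 * 'rV[F]_3)) : Prop :=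
  forall i j, (i < size L)%N -> (j < size L)%N -> i <> j ->
    ~ same_line (nth (0, 0) L i) (nth (0, 0) L j).

(* homogeneous coordinates (x0:x1:x2:x3) = (1:a0:a1:a2) of an affine point,
   after embedding F into K *)
Definition hom (F K : fieldType) (iota : {rmorphism F -> K}) (a : 'rV[F]_3)
  (i : 'I_4) : K :=
  if i == 0%N :> nat then 1 else iota (a 0 (inord i.-1)).

Definition plk (F K : fieldType) (iota : {rmorphism F -> K})
  (l : 'rV[F]_3 * 'rV[F]_3) (i j : nat) : K :=
  let x := hom iota l.1 in let y := hom iota (l.1 + l.2) in
  x (inord i) * y (inord j) - x (inord j) * y (inord i).

Definition pl_omega (F K : fieldType) (iota : {rmorphism F -> K})
  (l : 'rV[F]_3 * 'rV[F]_3) : 'rV[K]_3 :=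
  \row_(k < 3) [:: plk iota l 0 1; plk iota l 0 2; plk iota l 0 3]`_k.
Definition pl_v (F K : fieldType) (iota : {rmorphism F -> K})
  (l : 'rV[F]_3 * 'rV[F]_3) : 'rV[K]_3 :=
  \row_(k < 3) [:: plk iota l 2 3; plk iota l 3 1; plk iota l 1 2]`_k.

Definition dot3 (K : fieldType) (u v : 'rV[K]_3) : K := \sum_(k < 3) u 0 k * v 0 k.

(* All lines of L belong to one linear regular line complex: there is a
   normal vector N = [n : m] (with entries in some extension field K of F,
   e.g. the algebraic closure) with n . m <> 0 and N . P(l) = 0 for all l. *)
Definition in_regular_complex (F : fieldType) (L : seq ('rV[F]_3 * 'rV[F]_3)) : Prop :=
  exists (K : fieldType) (iota : {rmorphism F -> K}) (n m : 'rV[K]_3),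
    dot3 n m != 0 /\
    forall l, l \in L -> dot3 n (pl_omega iota l) + dot3 m (pl_v iota l) = 0.

Definition char_bound (F : fieldType) (n : nat) : Prop :=
  forall p : nat, p \in [pchar F] -> (n ^ 3 <= p ^ 4)%N.

Definition incidences (F : fieldType) (Q : seq 'rV[F]_3)
  (L : seq ('rV[F]_3 * 'rV[F]_3)) : nat :=
  (\sum_(q <- Q) \sum_(l <- L) (on_line l q : nat))%N.

Definition inc_bound (m n : nat) : Reals.Rdefinitions.R :=
  Reals.Rdefinitions.Rplus
    (Reals.Rdefinitions.Rplus
       (Reals.Rdefinitions.Rmult
          (Reals.R_sqrt.sqrt (Reals.R_sqrt.sqrt (Reals.Rpow_def.pow (Reals.Raxioms.INR m) 3)))
          (Reals.R_sqrt.sqrt (Reals.Raxioms.INR n)))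
       (Reals.Raxioms.INR m))
    (Reals.Raxioms.INR n).

(* Main.v *)
From Stdlib Require Import Reals Lra.
Require Import Defs.
From HB Require Import structures.
From mathcomp Require Import all_boot all_order all_algebra.
From mathcomp Require Import ring zify.
From mathcomp Require Import mpoly.
Set Implicit Arguments. Unset Strict Implicit. Unset Printing Implicit Defensive.
Import GRing.Theory.
Local Open Scope ring_scope.

(** In coordinates adapted to the complex, the points p and the lines l of the problem become
    points of K^3 with p incident to l iff p2 + l2 = p1 l1 and p3 + l3 = p1 l2.  For fixed l this
    is a line in p-space tangent to the contact distribution spanned by X = dx - y dz and
    Y = dy + x dz; for fixed p it is a line in l-space with null direction (1, p1, p1^2).

    (A) If each of n lines l carried more than d ~ n^(1/2) points lying on two lines, X and Y
    would preserve the polynomials of degree at most d vanishing on all lines, hence so would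
    [X, Y] = 2 dz, which lowers the degree: there would be no such polynomial, against a
    dimension count.  Removing poor lines one at a time bounds the number of rich points.

    (B) Let f vanish on the null lines of m points, with degree at most d ~ m^(1/2).  If k of
    them meet at l, then f vanishes to order at least k/2 at the vertex of the null cone of l.
    Counting these zeros along a null line with weighted multiplicities forces the gradient of f
    to vanish there, again contradicting minimality of the degree, unless some null line has
    sum of the k's O(m^(1/2)).  Removing such points one at a time gives sum_l k_l^2 = O(m^(3/2)),
    where l runs through the lines with 3 <= k_l = O(m^(1/2)), and Cauchy-Schwarz concludes.
    By (A) only O(n^(3/2)) points matter, so that both degrees are below the characteristic. *)

(** * Substitution into multivariate polynomials and parameter counting *)

Section Substitution.

Variables (n : nat) (R S : comNzRingType) (h : {rmorphism R -> S}).

Lemma mmap_eq (u v : 'I_n -> S) (f : {mpoly R[n]}) :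
  u =1 v -> mmap h u f = mmap h v f.
Proof.
by move=> uv; apply: eq_bigr => m _; rewrite (mmap1_eq m uv).
Qed.

Lemma rmorph_mmap (T : comNzRingType) (g : {rmorphism S -> T}) (h' : {rmorphism R -> T})
    (u : 'I_n -> S) (f : {mpoly R[n]}) :
  (forall c, g (h c) = h' c) -> g (mmap h u f) = mmap h' (fun i => g (u i)) f.
Proof.
move=> gh; rewrite /mmap rmorph_sum /=; apply: eq_bigr => m _.
rewrite rmorphM gh /mmap1 rmorph_prod; congr (_ * _).
by apply: eq_bigr => i _; rewrite rmorphXn.
Qed.

Lemma mmap_ind (P : S -> Prop) (u : 'I_n -> S) (f : {mpoly R[n]}) :
  (forall c, P (h c)) -> (forall i, P (u i)) ->
  (forall a b, P a -> P b -> P (a + b)) -> (forall a b, P a -> P b -> P (a * b)) ->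
  P (mmap h u f).
Proof.
move=> Pc Pu PD PM; rewrite /mmap.
have P0 : P 0 by rewrite -(rmorph0 h).
have P1 : P 1 by rewrite -(rmorph1 h).
apply: (big_ind P P0 PD) => m _; apply: (PM _ _ (Pc _)).
apply: (big_ind P P1 PM) => i _.
by elim: (m i) => [|k IH]; rewrite ?expr0 // exprS; apply: PM.
Qed.

(** Both sides are additive and obey the Leibniz rule in [f], so constants and variables suffice. *)
Lemma mmap_chain (D : S -> S) (u : 'I_n -> S) (f : {mpoly R[n]}) :
  (forall a b, D (a + b) = D a + D b) ->
  (forall a b, D (a * b) = D a * b + a * D b) ->
  (forall c, D (h c) = 0) ->
  D (mmap h u f) = \sum_i mmap h u (mderiv i f) * D (u i).
Proof.
move=> DD DM Dc.
pose P g := D (mmap h u g) = \sum_i mmap h u (mderiv i g) * D (u i).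
have PC c : P c%:MP.
  rewrite /P mmapC Dc big1 // => i _; by rewrite mderivC raddf0 mul0r.
have PD : forall a b, P a -> P b -> P (a + b).
  move=> a b Pa Pb; rewrite /P mmapD DD Pa Pb -big_split /=.
  by apply: eq_bigr => i _; rewrite mderivD mmapD mulrDl.
have PM : forall a b, P a -> P b -> P (a * b).
  move=> a b Pa Pb; rewrite /P rmorphM DM Pa Pb mulr_suml mulr_sumr -big_split /=.
  apply: eq_bigr => i _; rewrite mderivM mmapD !rmorphM /= mulrDl.
  by congr (_ + _); rewrite ?mulrA // mulrAC.
have PX i : P 'X_i.
  rewrite /P mmapX mmap1U (bigD1 i) //= mderivX mnm1E eqxx scale1r.
  have -> : (U_(i) - U_(i) = 0 :> 'X_{1..n})%MM.
    by apply/mnmP => j; rewrite mnmBE subnn mnm0E.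
  rewrite mmapX mmap11 mul1r.
  rewrite big1 ?addr0 // => j ji; rewrite mderivX mnm1E eq_sym (negPf ji).
  by rewrite scale0r raddf0 mul0r.
rewrite -/(P f) (mpolyE f); apply: (big_ind P _ PD) => [|m _].
  by rewrite -mpolyC0; apply: PC.
rewrite -mul_mpolyC; apply: (PM _ _ (PC _)).
rewrite mpolyXE_id; apply: (big_ind P _ PM) => [|i _].
  by rewrite -mpolyC1; apply: PC.
elim: (m i) => [|k IH]; first by rewrite expr0 -mpolyC1; apply: PC.
by rewrite exprS; apply: PM.
Qed.

End Substitution.

Lemma msize_mderiv (n d : nat) (R : comNzRingType) (i : 'I_n) (f : {mpoly R[n]}) :
  (msize f <= d.+1 -> msize (mderiv i f) <= d)%N.
Proof.
move=> fd; rewrite msizeE; apply/bigmax_leqP_seq => m + _.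
rewrite mcoeff_msupp mcoeff_deriv => nz.
have: (m + U_(i))%MM \in msupp f.
  by rewrite mcoeff_msupp; apply: contraNneq nz => ->; rewrite mul0rn.
move/msize_mdeg_lt; rewrite mdegD mdeg1 addn1 => lt.
by rewrite -ltnS; apply: leq_trans fd.
Qed.

(** A positive exponent in a monomial of [f] is at most [d], hence invertible in [K]: the derivative
    in that variable still sees the coefficient. *)
Lemma mderiv_eq0_const (n d : nat) (K : fieldType) (f : {mpoly K[n]}) :
  (forall i, (0 < i <= d)%N -> i%:R != 0 :> K) ->
  (msize f <= d.+1)%N -> (forall i, mderiv i f = 0) -> f = (f@_0)%:MP.
Proof.
move=> ch fd f0; apply/mpolyP => m; rewrite mcoeffC.
have [<-|m0] := eqVneq 0%MM m; first by rewrite mulr1.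
rewrite mulr0; have [ms|/memN_msupp_eq0 //] := boolP (m \in msupp f).
have [i mi] : exists i, (0 < m i)%N.
  apply/existsP; apply: contraNT m0; rewrite negb_exists => /forallP m0.
  by apply/eqP/mnmP => i; rewrite mnm0E; have:= m0 i; case: (m i).
have /(congr1 (fun g : {mpoly K[n]} => g@_(m - U_(i))%MM)) := f0 i.
have Um : (U_(i) <= m)%MM.
  by apply/mnm_lepP => j; rewrite mnm1E; case: eqP => [<-|].
rewrite mcoeff_deriv mcoeff0 submK //.
rewrite mnmBE mnm1E eqxx subn1 prednK // -mulr_natr => /eqP.
rewrite mulf_eq0 => /orP[/eqP//|]; rewrite (negPf (ch _ _)) // mi /=.
rewrite -ltnS; apply: leq_trans (fd); apply: leq_ltn_trans (msize_mdeg_lt ms).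
by rewrite mdegE (bigD1 i) //= leq_addr.
Qed.

Lemma size_mmap_le (n d : nat) (K : fieldType) (u : 'I_n -> {poly K}) (f : {mpoly K[n]}) :
  (forall i, (size (u i) <= 2)%N) -> (msize f <= d)%N ->
  (size (mmap (@polyC K) u f) <= d)%N.
Proof.
move=> su sf; rewrite /mmap.
apply: (leq_trans (size_sum _ _ _)); apply/bigmax_leqP_seq => m mf _.
apply: leq_trans sf; apply: leq_trans (msize_mdeg_lt mf).
rewrite mul_polyC; apply: (leq_trans (size_scale_leq _ _)).
rewrite /mmap1 mdegE.
elim/big_rec2: _ => [|i y1 y2 _ IH]; first by rewrite size_poly1.
have E : (size (u i ^+ m i) <= (m i).+1)%N.
  elim: (m i) => [|k IHk]; first by rewrite expr0 size_poly1.
  rewrite exprS; apply: (leq_trans (size_polyMleq _ _)).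
  by rewrite -subn1 leq_subLR; apply: leq_trans (leq_add (su i) IHk) _.
apply: (leq_trans (size_polyMleq _ _)); rewrite -subn1 leq_subLR.
by apply: leq_trans (leq_add E IH) _; rewrite addnS addSn.
Qed.

(** Parameter count: [e.+1 ^ n] monomials have all exponents at most [e], and each curve [u t]
    imposes one linear condition per coefficient of the restriction. *)
Lemma exists_vanishing (n e : nat) (K : fieldType) (T : eqType) (s : seq T)
    (u : T -> 'I_n -> {poly K}) :
  (forall t i, (size (u t i) <= 2)%N) -> (size s * (n * e).+1 < e.+1 ^ n)%N ->
  exists f : {mpoly K[n]}, [/\ f != 0, (msize f <= (n * e).+1)%N
    & forall t, t \in s -> mmap (@polyC K) (u t) f = 0].
Proof.
move=> su lt; set d := (n * e).+1.
pose J := {ffun 'I_n -> 'I_e.+1}.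
pose mono (j : J) : 'X_{1..n} := [multinom (j i : nat) | i < n].
have mono_inj : injective mono.
  move=> j k jk; apply/ffunP => i; apply: val_inj => /=.
  by have := congr1 (fun m : 'X_{1..n} => m i) jk; rewrite !mnmE.
have mdeg_mono j : (mdeg (mono j) < d)%N.
  rewrite mdegE ltnS; apply: (@leq_trans (\sum_(i < n) e)%N).
    by apply: leq_sum => i _; rewrite mnmE -ltnS.
  by rewrite sum_nat_const card_ord.
case: s lt => [|t0 s'] lt.
  exists 1; split => //; first by rewrite oner_neq0.
  by rewrite msize1.
set s := t0 :: s' in lt *.
pose C := ('I_(size s) * 'I_d)%type.
pose col_of (c : 'I_#|{: C}|) : C := enum_val c.
pose row_of (r : 'I_#|{: J}|) : J := enum_val r.
pose M : 'M[K]_(#|{: J}|, #|{: C}|) := \matrix_(r, c)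
  (mmap (@polyC K) (u (nth t0 s (col_of c).1)) 'X_[mono (row_of r)])`_((col_of c).2).
(* There are more rows (monomials) than columns (conditions); a vector of the left kernel lists the
   coefficients of [f]. *)
have : kermx M != 0.
  rewrite kermx_eq0 -row_leq_rank -ltnNge.
  apply: (leq_ltn_trans (rank_leq_col M)).
  by rewrite card_ffun card_prod !card_ord.
case/rowV0Pn => v /sub_kermxP vM v0.
pose f : {mpoly K[n]} := \sum_(r < #|{: J}|) v 0 r *: 'X_[mono (row_of r)].
have fd : (msize f <= d)%N.
  apply: (leq_trans (mmeasure_sum _ _ _ _)); apply/bigmax_leqP => r _.
  by apply: (leq_trans (msizeZ_le _ _)); rewrite msizeX.
exists f; split=> // [|t ts].
  apply: contraNneq v0 => f0; apply/eqP/rowP => r; rewrite mxE.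
  have := congr1 (fun g : {mpoly K[n]} => g@_(mono (row_of r))) f0.
  rewrite mcoeff0 raddf_sum (bigD1 r) //= mcoeffZ mcoeffX eqxx mulr1.
  rewrite big1 ?addr0 // => k kr; rewrite mcoeffZ mcoeffX.
  case: eqP => [/mono_inj/enum_val_inj E|_]; last by rewrite mulr0.
  by rewrite E eqxx in kr.
apply/polyP => k; rewrite coef0.
have [kd|dk] := ltnP k d; last first.
  by rewrite nth_default //; apply: leq_trans dk; apply: size_mmap_le.
have ti : (index t s < size s)%N by rewrite index_mem.
pose c : C := (Ordinal ti, Ordinal kd).
have := congr1 (fun A : 'rV_ _ => A 0 (enum_rank c)) vM.
rewrite !mxE => E; rewrite -[RHS]E /f raddf_sum coef_sum /=; apply: eq_bigr => r _.
by rewrite !mxE /col_of enum_rankK /= nth_index // mmapZ mul_polyC coefZ.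
Qed.

(** * Zeros of univariate polynomials *)

Lemma size_horner_roots (K : fieldType) (q : {poly K}) (s : seq K) :
  uniq s -> all (root q) s -> (size q <= size s)%N -> q = 0.
Proof.
move=> us rs le; apply/eqP; apply: contraT => q0.
by have := max_poly_roots q0 rs us; rewrite ltnNge le.
Qed.

Lemma multiple_roots_eq0 (K : fieldType) (I : eqType) (r : seq I) (c : I -> K)
    (k : I -> nat) (q : {poly K}) :
  uniq [seq c i | i <- r] -> {in r, forall i, ('X - (c i)%:P) ^+ k i %| q} ->
  (size q <= \sum_(i <- r) k i)%N -> q = 0.
Proof.
move=> uc dvd le; apply/eqP; apply: contraT => q0.
have dq : \prod_(i <- r) ('X - (c i)%:P) ^+ k i %| q.
  elim: r uc dvd {le} => [|i r IH] /=; first by rewrite big_nil dvd1p.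
  case/andP => ci uc dvd; rewrite big_cons Gauss_dvdp.
    by rewrite dvd ?mem_head // IH // => j jr; apply: dvd; rewrite inE jr orbT.
  rewrite coprimep_expl // big_seq; apply: (big_ind (coprimep _)) => //.
  - exact: coprimep1.
  - by move=> a b; rewrite coprimepMr => -> ->.
  move=> j jr; apply: coprimep_expr; rewrite coprimep_XsubC root_XsubC.
  by apply: contraNneq ci => <-; apply: map_f.
have := dvdp_leq q0 dq.
have -> : size (\prod_(i <- r) ('X - (c i)%:P) ^+ k i) = (\sum_(i <- r) k i).+1.
  elim: r {uc dvd le dq} => [|i r IH]; first by rewrite !big_nil size_poly1.
  have mon : \prod_(j <- r) ('X - (c j)%:P) ^+ k j \is monic.
    by apply: monic_prod => j _; apply: monic_exp; apply: monicXsubC.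
  rewrite !big_cons size_Mmonic ?expf_neq0 ?polyXsubC_eq0 //.
  by rewrite IH size_exp_XsubC addSn addnS.
by rewrite ltnNge le.
Qed.

Lemma dvdp_deriv_XsubC (K : fieldType) (c : K) (k : nat) (q : {poly K}) :
  ('X - c%:P) ^+ k.+1 %| q -> ('X - c%:P) ^+ k %| q^`().
Proof.
case/dvdpP => g ->; rewrite derivM deriv_exp derivXsubC mul1r.
by rewrite dvdp_addr ?dvdp_mull // ?dvdp_exp2l // -mulr_natr dvdp_mulr // dvdp_mull.
Qed.

(** Induction on the size of [H]: top coefficients force equal degrees, and subtracting a multiple
    of [A] keeps the identity and lowers the degree. The bound [d] excludes nonconstant quotients
    with zero derivative, such as p-th powers. *)
Lemma wronskian_eq0 (K : fieldType) (d : nat) (A H : {poly K}) :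
  (forall i, (0 < i <= d)%N -> i%:R != 0 :> K) ->
  (size A <= d.+1)%N -> (size H <= d.+1)%N ->
  A != 0 -> H^`() * A = H * A^`() -> exists c, H = c *: A.
Proof.
move=> ch sA; have [N] := ubnP (size H); elim: N H => // N IH H HN sH A0 W.
have [->|H0] := eqVneq H 0; first by exists 0; rewrite scale0r.
have sA0 : (0 < size A)%N by rewrite size_poly_gt0.
have sH0 : (0 < size H)%N by rewrite size_poly_gt0.
have coef_top (p q : {poly K}) : p != 0 -> q != 0 ->
    (p^`() * q)`_((size p).-1 + (size q).-1).-1 =
    lead_coef p * lead_coef q *+ (size p).-1.
  move=> p0 q0; have sp : (0 < size p)%N by rewrite size_poly_gt0.
  have [p1|p1] := ltnP 1 (size p); last first.
    have -> : p^`() = 0 by rewrite (size1_polyC p1) derivC.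
    have -> : (size p).-1 = 0%N by lia.
    by rewrite mul0r coef0 mulr0n.
  have szp : (size p^`() <= (size p).-1)%N by rewrite -ltnS prednK // lt_size_deriv.
  rewrite coefM (bigD1 (inord (size p).-2)) //= inordK; last by lia.
  rewrite big1 ?addr0; last first.
    move=> i; rewrite -val_eqE /= inordK; last by lia.
    move=> ne; have [lt|ge] := ltnP i (size p).-1; last first.
      by rewrite nth_default ?mul0r //; apply: leq_trans ge.
    rewrite [X in _ * X]nth_default ?mulr0 //.
    case: i ne lt => i /= _; move: sp p1; move: (size p) (size q) => a b sp p1 ne lt. lia.
  rewrite coef_deriv.
  have -> : (size p).-2.+1 = (size p).-1 by lia.
  have -> : (((size p).-1 + (size q).-1).-1 - (size p).-2 = (size q).-1)%N by lia.
  by rewrite mulrnAl.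
have := congr1 (fun q : {poly K} => q`_((size H).-1 + (size A).-1).-1) W.
rewrite /= (coef_top _ _ H0 A0) (mulrC H) [((size H).-1 + _)%N]addnC (coef_top _ _ A0 H0).
rewrite (mulrC (lead_coef H)) => E.
have lcn0 : lead_coef A * lead_coef H != 0 by rewrite mulf_neq0 ?lead_coef_eq0.
(* [E] equates the two degrees only in [K]; degrees up to [d] that differ stay different there. *)
have neq (a b : nat) : (a < b <= d)%N ->
    lead_coef A * lead_coef H *+ a != lead_coef A * lead_coef H *+ b.
  move=> /andP[ab bd]; rewrite -subr_eq0 -opprB oppr_eq0 -mulrnBr; last exact: ltnW.
  rewrite -mulr_natr mulf_neq0 // ch //; lia.
have szE : size H = size A.
  have [ha|ha|/eqP ha] := ltngtP (size H).-1 (size A).-1.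
  - by move/eqP: E; rewrite (negPf (neq _ _ _)) // ha -ltnS prednK.
  - by move/eqP: E; rewrite eq_sym (negPf (neq _ _ _)) // ha -ltnS prednK.
  by rewrite -(prednK sH0) (eqP ha) prednK.
pose c := lead_coef H / lead_coef A.
have [N0|HcA] := eqVneq (H - c *: A) 0.
  by exists c; apply/eqP; rewrite -subr_eq0 N0.
have lt : (size (H - c *: A)%R < size H)%N.
  rewrite -(prednK sH0) ltnS; apply/leq_sizeP => j; rewrite leq_eqVlt coefB coefZ.
  case/orP=> [/eqP <-|]; last first.
    by move=> lt; rewrite !nth_default ?mulr0 ?subr0 //; rewrite -?szE -(prednK sH0).
  have -> : A`_(size H).-1 = lead_coef A by rewrite szE lead_coefE.
  by rewrite -lead_coefE /c divfK ?subrr // lead_coef_eq0.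
case: (IH (H - c *: A)) => //.
- exact: leq_trans lt _.
- exact: leq_trans (ltnW lt) _.
- by rewrite derivB derivZ mulrBl mulrBl W -!scalerAl (mulrC A^`()).
by move=> c' /eqP; rewrite subr_eq -scalerDl => /eqP ->; exists (c' + c).
Qed.

(** * Step (A): contact fields and lines rich in points *)

Section Incidence.

Variable K : fieldType.
Implicit Types (p l : K * K * K) (P L : seq (K * K * K)).

Definition incident p l : bool :=
  (p.1.2 + l.1.2 == p.1.1 * l.1.1) && (p.2 + l.2 == p.1.1 * l.1.2).

Definition coord3 (A : nmodType) (x y z : A) : 'I_3 -> A := fun i => nth 0 [:: x; y; z] i.

Lemma sum_coord3 (A : nmodType) (F : 'I_3 -> A) :
  \sum_i F i = F (inord 0) + F (inord 1) + F (inord 2).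
Proof.
rewrite !big_ord_recl big_ord0 addr0 addrA.
by congr (F _ + F _ + F _); apply: val_inj; rewrite /= inordK.
Qed.

Lemma coord3_inord (A : nmodType) (x y z : A) :
  (coord3 x y z (inord 0) = x) * (coord3 x y z (inord 1) = y) * (coord3 x y z (inord 2) = z).
Proof. by rewrite /coord3 !inordK. Qed.

Definition point_line l : 'I_3 -> {poly K} :=
  coord3 'X (l.1.1 *: 'X - l.1.2%:P) (l.1.2 *: 'X - l.2%:P).

Lemma size_lin (a b : K) : (size (a *: 'X - b%:P)%R <= 2)%N.
Proof.
by apply/leq_sizeP => -[|[|j]] // _; rewrite !coefE mulr0 subr0.
Qed.

Lemma size_point_line l i : (size (point_line l i) <= 2)%N.
Proof.
by case: i => [[|[|[|[]]]] hi] //=; rewrite /point_line /coord3 /= ?size_polyX ?size_lin.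
Qed.

Notation "f `_x" := (mderiv (inord 0) f) (at level 3, format "f `_x").
Notation "f `_y" := (mderiv (inord 1) f) (at level 3, format "f `_y").
Notation "f `_z" := (mderiv (inord 2) f) (at level 3, format "f `_z").

Definition fieldX (f : {mpoly K[3]}) := f`_x - 'X_(inord 1) * f`_z.
Definition fieldY (f : {mpoly K[3]}) := f`_y + 'X_(inord 0) * f`_z.

Lemma field_comm f : fieldX (fieldY f) - fieldY (fieldX f) = f`_z *+ 2.
Proof.
rewrite /fieldX /fieldY !mderivB !mderivD !mderivM !mderivX !mnm1E -!val_eqE /= !inordK //=.
rewrite !scale0r !mul0r !scale1r.
have E i : (U_(i) - U_(i) = 0 :> 'X_{1..3})%MM.
  by apply/mnmP => j; rewrite mnmBE subnn mnm0E.
rewrite !E !mpolyX0 (mderiv_comm (inord 1) (inord 0)) (mderiv_comm (inord 2) (inord 0)).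
rewrite (mderiv_comm (inord 2) (inord 1)).
ring.
Qed.

Lemma msizeXM_le (i : 'I_3) (g : {mpoly K[3]}) k :
  (msize g <= k)%N -> (msize ('X_i * g)%R <= k.+1)%N.
Proof.
move=> gk; have [->|g0] := eqVneq g 0; first by rewrite mulr0 msize0.
have X0 : 'X_i != 0 :> {mpoly K[3]} by rewrite -msize_poly_eq0 msizeX mdeg1.
by rewrite msizeM // msizeX mdeg1.
Qed.

Lemma msize_fieldX k f : (msize f <= k.+1)%N -> (msize (fieldX f) <= k.+1)%N.
Proof.
move=> fk; apply: leq_trans (mmeasureD_le _ _ _) _; rewrite mmeasureN geq_max.
by rewrite (leq_trans (msize_mderiv _ fk)) // msizeXM_le // msize_mderiv.
Qed.

Lemma msize_fieldY k f : (msize f <= k.+1)%N -> (msize (fieldY f) <= k.+1)%N.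
Proof.
move=> fk; apply: leq_trans (mmeasureD_le _ _ _) _; rewrite geq_max.
by rewrite (leq_trans (msize_mderiv _ fk)) // msizeXM_le // msize_mderiv.
Qed.

Lemma count_other (T : eqType) (s : seq T) (a : pred T) (x : T) :
  uniq s -> (1 < count a s)%N -> exists y, [/\ y \in s, a y & y != x].
Proof.
move=> us lt; suff /hasP[y ys /andP[ay yx]] : has (fun y => a y && (y != x)) s by exists y.
apply: contraTT lt => /hasPn no; rewrite -leqNgt.
apply: (@leq_trans (count_mem x s)); last by rewrite count_uniq_mem // leq_b1.
rewrite -!size_filter; apply: uniq_leq_size; first exact: filter_uniq.
move=> y; rewrite !mem_filter => /andP[ay ys]; rewrite ys andbT /=.
by have := no y ys; rewrite ay /= negbK.
Qed.

Definition at_point p : 'I_3 -> K := coord3 p.1.1 p.1.2 p.2.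

Lemma horner_point_line p l f : incident p l ->
  (mmap (@polyC K) (point_line l) f).[p.1.1] = mmap idfun (at_point p) f.
Proof.
case/andP => /eqP e1 /eqP e2.
rewrite -[LHS]/(horner_eval p.1.1 _) (rmorph_mmap (h' := idfun)); last first.
  by move=> c /=; rewrite /horner_eval hornerC.
apply: mmap_eq => i; rewrite /point_line /at_point /coord3.
case: i => [[|[|[|[]]]] hi] //=.
- by rewrite horner_evalE hornerX.
- by rewrite horner_evalE hornerD hornerN hornerZ hornerX hornerC mulrC -e1 addrK.
- by rewrite horner_evalE hornerD hornerN hornerZ hornerX hornerC mulrC -e2 addrK.
Qed.

(** Incidence gives l2 = p1 l1 - p2, so the direction (1, l1, l2) of [l] is X + l1 Y at [p]. *)
Lemma deriv_point_line p l f : incident p l -> mmap (@polyC K) (point_line l) f = 0 ->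
  mmap idfun (at_point p) (fieldX f) + l.1.1 * mmap idfun (at_point p) (fieldY f) = 0.
Proof.
move=> inc f0.
have := @mmap_chain 3 K {poly K} (@polyC K) (@deriv K) (point_line l) f
  (@derivD _) (@derivM _) (@derivC _).
rewrite f0 deriv0 => /(congr1 (horner^~ p.1.1)); rewrite horner0 sum_coord3 /= !hornerE.
rewrite !horner_point_line // /point_line !coord3_inord !derivE !hornerE.
rewrite /fieldX /fieldY rmorphB rmorphD !rmorphM /= !mmapX !mmap1U /at_point !coord3_inord.
case/andP: inc => /eqP /(canRL (addKr _)) -> _.
by move=> E; rewrite [RHS]E; ring.
Qed.

Lemma incident_line_inj p l l' : incident p l -> incident p l' -> l.1.1 = l'.1.1 -> l = l'.
Proof.
case: p l l' => [[p1 p2] p3] [[l1 l2] l3] [[l1' l2'] l3'].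
rewrite /incident /= => /andP[/eqP e1 /eqP e2] /andP[/eqP e1' /eqP e2'] e; subst l1'.
move: e1; rewrite -e1' => /addrI e; subst l2'.
by move: e2; rewrite -e2' => /addrI ->.
Qed.

Lemma incident_point_inj p p' l : incident p l -> incident p' l -> p.1.1 = p'.1.1 -> p = p'.
Proof.
case: p p' l => [[p1 p2] p3] [[p1' p2'] p3'] [[l1 l2] l3].
rewrite /incident /= => /andP[/eqP e1 /eqP e2] /andP[/eqP e1' /eqP e2'] e; subst p1'.
by move: e1 e2; rewrite -e1' -e2' => /addIr -> /addIr ->.
Qed.

Section RichPoints.

Variables (P L : seq (K * K * K)) (d : nat).
Hypothesis Puniq : uniq P.
Hypothesis Luniq : uniq L.
Hypothesis Lrich : {in L, forall l,
  (d < count (fun p => incident p l && (1 < count (incident p) L)) P)%N}.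

Let vanishes f := forall l, l \in L -> mmap (@polyC K) (point_line l) f = 0.

(** A second line through [p] has another slope l1', and X + l1 Y and X + l1' Y span both fields. *)
Lemma fields_vanish_at p l f : l \in L -> incident p l -> (1 < count (incident p) L)%N ->
  vanishes f -> mmap idfun (at_point p) (fieldX f) = 0 /\ mmap idfun (at_point p) (fieldY f) = 0.
Proof.
move=> lL pl /(count_other l Luniq)[l' [l'L pl' l'l]] f0.
have E := deriv_point_line pl (f0 _ lL); have E' := deriv_point_line pl' (f0 _ l'L).
move: (mmap _ _ (fieldX f)) (mmap _ _ (fieldY f)) E E' => x y E E'.
have y0 : y = 0.
  have /eqP : (l'.1.1 - l.1.1) * y = 0.
    by transitivity ((x + l'.1.1 * y) - (x + l.1.1 * y)); [ring | rewrite E E' subrr].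
  rewrite mulf_eq0 subr_eq0 => /orP[/eqP e|/eqP //].
  by rewrite (incident_line_inj pl' pl e) eqxx in l'l.
by rewrite y0 mulr0 addr0 in E.
Qed.

(** The restriction to [l] has size at most d + 1 and, by [Lrich], at least d + 1 roots. *)
Lemma vanishes_of_rich g :
  (msize g <= d.+1)%N ->
  (forall p l, l \in L -> incident p l -> (1 < count (incident p) L)%N ->
     mmap idfun (at_point p) g = 0) -> vanishes g.
Proof.
move=> gd g0 l lL.
pose s := [seq p <- P | incident p l && (1 < count (incident p) L)%N].
apply: (@size_horner_roots _ _ [seq p.1.1 | p <- s]).
- rewrite map_inj_in_uniq ?filter_uniq // => p p'.
  rewrite !mem_filter => /andP[/andP[pl _] _] /andP[/andP[p'l _] _].
  exact: incident_point_inj pl p'l.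
- apply/allP => c /mapP[p ps ->]; move: ps; rewrite mem_filter => /andP[/andP[pl rp] _].
  by rewrite /root horner_point_line // (g0 p l).
rewrite size_map size_filter; apply: leq_trans (Lrich lL).
by apply: size_mmap_le gd => i; apply: size_point_line.
Qed.

Lemma fields_vanish f : (msize f <= d.+1)%N -> vanishes f ->
  vanishes (fieldX f) /\ vanishes (fieldY f).
Proof.
move=> fd f0; split; apply: vanishes_of_rich.
- exact: msize_fieldX.
- by move=> p l lL pl rp; case: (fields_vanish_at lL pl rp f0).
- exact: msize_fieldY.
- by move=> p l lL pl rp; case: (fields_vanish_at lL pl rp f0).
Qed.

(* X and Y span the contact distribution; as [X, Y] = 2 d/dz lowers the degree, the
   ideal of L, which X and Y preserve, has no element of least degree. *)
Lemma vanishes_on_rich_lines_eq0 f :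
  (1 < d)%N -> (forall i, (0 < i <= d)%N -> i%:R != 0 :> K) -> L != [::] ->
  (msize f <= d.+1)%N -> vanishes f -> f = 0.
Proof.
move=> d1 ch Ln0.
have [l0 l0L] : exists l, l \in L by case: L Ln0 => // l *; exists l; apply: mem_head.
suff H k : (k <= d.+1)%N -> forall g, (msize g <= k)%N -> vanishes g -> g = 0 by apply: H.
elim: k => [|k IH] kd g gk g0.
  by apply/eqP; rewrite -msize_poly_eq0 -leqn0.
have gd : (msize g <= d.+1)%N by apply: leq_trans kd.
have [gX gY] := fields_vanish gd g0.
have [XY _] := fields_vanish (msize_fieldY gd) gY.
have [_ YX] := fields_vanish (msize_fieldX gd) gX.
have gz : g`_z = 0.
  apply: IH (ltnW kd) _ (msize_mderiv _ gk) _ => l lL.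
  have : mmap (@polyC K) (point_line l) (g`_z *+ 2) = 0.
    by rewrite -field_comm rmorphB /= XY // YX // subr0.
  rewrite raddfMn /= -mulr_natr => /eqP; rewrite mulf_eq0 => /orP[/eqP //|].
  by rewrite -polyC_natr polyC_eq0 (negPf (ch _ _)).
(* Once the z-derivative is zero, the two fields reduce to the x- and y-derivatives, which have
   lower degree. *)
move: gX gY; rewrite /fieldX /fieldY gz !mulr0 subr0 addr0 => gX gY.
have gx : g`_x = 0 by apply: IH (ltnW kd) _ (msize_mderiv _ gk) gX.
have gy : g`_y = 0 by apply: IH (ltnW kd) _ (msize_mderiv _ gk) gY.
have gC : g = (g@_0)%:MP.
  apply: (mderiv_eq0_const ch gd) => i.
  have [i0|i1|i2] : [\/ i = inord 0, i = inord 1 | i = inord 2].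
    by case: i => [[|[|[|[]]]] hi] //; [apply: Or31|apply: Or32|apply: Or33];
      apply: val_inj; rewrite /= inordK.
  - by rewrite i0.
  - by rewrite i1.
  by rewrite i2.
have /eqP := g0 _ l0L; rewrite gC mmapC polyC_eq0 => /eqP ->.
by rewrite mpolyC0.
Qed.

End RichPoints.

End Incidence.

(** * Step (B): univariate pencils, null lines and null cones *)

Lemma uniq_map_inj_in (T1 T2 : eqType) (f : T1 -> T2) (s : seq T1) :
  uniq [seq f x | x <- s] -> {in s &, injective f}.
Proof.
elim: s => //= z s IH /andP[zs us] x y; rewrite !inE.
case/predU1P=> [->|xs] /predU1P[->|ys] // e; last exact: IH.
- by rewrite e map_f in zs.
- by rewrite -e map_f in zs.
Qed.

Lemma dvdp_shift (K : fieldType) (c : K) (r : nat) (q : {poly K}) :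
  (forall j, (j < r)%N -> (q \Po ('X + c%:P))`_j = 0) -> ('X - c%:P) ^+ r %| q.
Proof.
move=> q0.
have E : q = (q \Po ('X + c%:P)) \Po ('X - c%:P).
  by rewrite -comp_polyA comp_polyD comp_polyX comp_polyC subrK comp_polyXr.
have D : 'X^r %| q \Po ('X + c%:P).
  rewrite -(poly_take_drop r (q \Po _)).
  have -> : take_poly r (q \Po ('X + c%:P)) = 0.
    by apply/polyP => j; rewrite coef_take_poly coef0; case: ltnP => // /q0.
  by rewrite add0r dvdp_mull.
rewrite E; case/dvdpP: D => g ->.
by rewrite comp_polyM comp_Xn_poly dvdp_mull.
Qed.

Lemma double_root_dvdp (K : fieldType) (c : K) (q : {poly K}) :
  root q c -> root q^`() c -> ('X - c%:P) ^+ 2 %| q.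
Proof.
rewrite -dvdp_XsubCl => /dvdpP[g ->].
rewrite derivM derivXsubC mulr1 rootE hornerD hornerM !hornerE subrr mulr0 add0r.
by rewrite -rootE -dvdp_XsubCl expr2 => ?; rewrite dvdp_mul.
Qed.

(* Differentiating the divisibilities gives enough zeros to kill the Wronskian of
   A and 'X * A + 2 B; then 'X * A + 2 B = c0 A, and A has too many zeros away from c0. *)
Lemma pencil_eq0 (K : fieldType) (I : eqType) (r : seq I) (c : I -> K) (k : I -> nat)
    (A B : {poly K}) (d M : nat) :
  (1 < d)%N -> (forall i, (0 < i <= d)%N -> i%:R != 0 :> K) ->
  uniq [seq c i | i <- r] -> (size A <= d)%N -> (size B <= d)%N ->
  {in r, forall i, ('X - (c i)%:P) ^+ (k i).-1 %| ('X - (c i)%:P) * A + B *+ 2} ->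
  {in r, forall i, (k i <= M)%N} ->
  (2 * d + M <= \sum_(i <- r) (k i - 2))%N -> B = 0.
Proof.
move=> d1 ch uc sA sB dvd kM le.
have ur : uniq r by apply: map_uniq uc.
have le21 i : (k i - 2 <= (k i).-1)%N by lia.
pose H := 'X * A + B *+ 2.
have sz2 (a b : {poly K}) : (size a <= d -> size b <= d -> size (a * b)%R <= 2 * d)%N.
  move=> sa sb; apply: (leq_trans (size_polyMleq _ _)).
  by rewrite mul2n -addnn (leq_trans (leq_pred _)) // leq_add.
(* Replacing 'X by 'X - c i changes [H] by a multiple of [A] and leaves the Wronskian alone;
   differentiation costs one order, whence [k i - 2]. *)
have W : H^`() * A - H * A^`() = 0.
  apply: (@multiple_roots_eq0 _ _ r c (fun i => k i - 2)%N) => // [i ir|].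
    have -> : H^`() * A - H * A^`() = (('X - (c i)%:P) * A + B *+ 2)^`() * A
        - (('X - (c i)%:P) * A + B *+ 2) * A^`().
      by rewrite /H !derivE; ring.
    have [k1|k1] := leqP (k i) 1; first by rewrite (_ : k i - 2 = 0)%N ?expr0 ?dvd1p //; lia.
    rewrite dvdp_sub // dvdp_mulr //.
      apply: dvdp_deriv_XsubC; rewrite (_ : (k i - 2).+1 = (k i).-1) ?dvd //; lia.
    by apply: dvdp_trans (dvd i ir); apply: dvdp_exp2l.
  (* Expanding cancels the terms with 'X, which keeps the size within [2 * d]. *)
  have -> : H^`() * A - H * A^`() = A * A + (B^`() * A - B * A^`()) *+ 2.
    by rewrite /H !derivE; ring.
  apply: leq_trans le; apply: leq_trans (leq_addr M _).
  have sd (a : {poly K}) : (size a <= d)%N -> (size a^`() <= d)%N.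
    by move=> sa; apply: leq_trans (leq_trans (size_poly _ _) (leq_pred _)) sa.
  apply: (leq_trans (size_polyD _ _)); rewrite geq_max sz2 // mulr2n.
  have s1 : (size (B^`() * A - B * A^`())%R <= 2 * d)%N.
    apply: (leq_trans (size_polyD _ _)); rewrite size_polyN geq_max.
    by rewrite !sz2 // sd.
  by apply: (leq_trans (size_polyD _ _)); rewrite geq_max s1.
have A0 : A = 0.
  apply/eqP; apply: contraT => A0.
  have sH : (size H <= d.+1)%N.
    apply: (leq_trans (size_polyD _ _)); rewrite geq_max mulr2n; apply/andP; split.
      apply: (leq_trans (size_polyMleq _ _)); rewrite size_polyX.
      by rewrite /= ltnS.
    apply: (leq_trans (size_polyD _ _)); rewrite maxnn; exact: leqW.
  case: (wronskian_eq0 ch (leqW sA) sH A0) => [|c0 HA].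
    by apply/eqP; rewrite -subr_eq0 W.
  have dvdA i : i \in r -> c i != c0 -> ('X - (c i)%:P) ^+ (k i - 2) %| A.
    move=> ir ic; apply: (dvdp_trans (dvdp_exp2l _ (le21 i))).
    have := dvd i ir; have -> : ('X - (c i)%:P) * A + B *+ 2 = (c0 - c i) *: A.
      rewrite scalerBl -HA /H -mul_polyC; ring.
    by rewrite dvdpZr // subr_eq0 eq_sym.
  (* At most one node equals [c0]; discarding it costs at most [M], whence the summand [M] in the
     hypothesis. *)
  case/eqP: A0; have [/hasP[i0 i0r /eqP ci0]|no] := boolP (has (fun i => c i == c0) r).
    apply: (@multiple_roots_eq0 _ _ [seq i <- r | i != i0] c (fun i => k i - 2)%N).
    - by rewrite (subseq_uniq _ uc) // map_subseq // filter_subseq.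
    - move=> i; rewrite mem_filter => /andP[ii0 ir]; apply: dvdA => //.
      by apply: contraNneq ii0 => cc; apply/eqP/(uniq_map_inj_in uc); rewrite // ci0.
    apply: (leq_trans sA); move: le; rewrite (bigD1_seq i0) //= big_filter.
    have := kM i0 i0r; lia.
  apply: (@multiple_roots_eq0 _ _ r c (fun i => k i - 2)%N) => // [i ir|].
    by apply: dvdA => //; apply: contraNneq no => <-; apply/hasP; exists i.
  apply: (leq_trans sA); apply: leq_trans le; lia.
apply: (@multiple_roots_eq0 _ _ r c (fun i => k i - 2)%N) => // [i ir|].
  apply: (dvdp_trans (dvdp_exp2l _ (le21 i))).
  have := dvd i ir; rewrite A0 mulr0 add0r -scaler_nat dvdpZr //.
  by apply: ch; rewrite d1.
apply: (leq_trans sB); apply: leq_trans le; lia.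
Qed.

(** The lines through [p], parametrised by their first coordinate: the incidence equations solved
    for [l]. *)
Definition line_of_point (K : fieldType) (p : K * K * K) : 'I_3 -> {poly K} :=
  coord3 'X (p.1.1 *: 'X - p.1.2%:P) (p.1.1 ^+ 2 *: 'X - (p.1.1 * p.1.2 + p.2)%:P).

Lemma size_line_of_point (K : fieldType) (p : K * K * K) i : (size (line_of_point p i) <= 2)%N.
Proof.
by case: i => [[|[|[|[]]]] hi] //=; rewrite /line_of_point /coord3 /= ?size_polyX ?size_lin.
Qed.

Definition on_line_of (K : fieldType) (p : K * K * K) (f : {mpoly K[3]}) : {poly K} :=
  mmap (@polyC K) (line_of_point p) f.

Notation "f `_a" := (mderiv (inord 0) f) (at level 3, format "f `_a").
Notation "f `_b" := (mderiv (inord 1) f) (at level 3, format "f `_b").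
Notation "f `_c" := (mderiv (inord 2) f) (at level 3, format "f `_c").

(** Derivative in the direction (0, 1, 2 p1), the velocity of (1, t, t^2) at t = p1; [normal_deriv2]
    is the second derivative in this fixed direction. *)
Definition normal_deriv (K : fieldType) (p : K * K * K) (f : {mpoly K[3]}) : {poly K} :=
  on_line_of p f`_b + (p.1.1 *+ 2) *: on_line_of p f`_c.
Definition normal_deriv2 (K : fieldType) (p : K * K * K) (f : {mpoly K[3]}) : {poly K} :=
  on_line_of p f`_b`_b + (p.1.1 *+ 4) *: on_line_of p f`_b`_c
  + (p.1.1 ^+ 2 *+ 4) *: on_line_of p f`_c`_c.

(* The cone of lines through l, parametrised by l + s (1, t, t ^ 2).  The ring S stands for
   K[t][s], kept abstract here with its derivation D = d/dt and its evaluations in t. *)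
Section Cone.

Variables (K : fieldType) (S : comNzRingType) (const : {rmorphism K -> S}) (s t : S).
Variables (D : S -> S).
Hypothesis DD : forall a b, D (a + b) = D a + D b.
Hypothesis DM : forall a b, D (a * b) = D a * b + a * D b.
Hypothesis D_const : forall c, D (const c) = 0.
Hypothesis D_s : D s = 0.
Hypothesis D_t : D t = 1.

Variables (p l : K * K * K) (ev : {rmorphism S -> {poly K}}).
Hypothesis pl : incident p l.
Hypothesis ev_const : forall c, ev (const c) = c%:P.
Hypothesis ev_s : ev s = 'X.
Hypothesis ev_t : ev t = p.1.1%:P.

Definition cone : 'I_3 -> S :=
  coord3 (const l.1.1 + s) (const l.1.2 + s * t) (const l.2 + s * t ^+ 2).
Definition on_cone (f : {mpoly K[3]}) : S := mmap const cone f.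

Implicit Types f : {mpoly K[3]}.

(** At t = p1 the ruling of the cone is the null line of [p]; the shift by [l.1.1] moves [l] to s =
    0. *)
Lemma on_cone_at f : ev (on_cone f) = on_line_of p f \Po ('X + l.1.1%:P).
Proof.
case/andP: pl => /eqP e1 /eqP e2.
rewrite /on_cone (rmorph_mmap (h' := @polyC K)) //.
rewrite /on_line_of -[RHS]/(comp_poly _ _) (rmorph_mmap (h' := @polyC K)); last first.
  by move=> c /=; rewrite comp_polyC.
apply: mmap_eq; case=> [[|[|[|[]]]] hi] //=; rewrite /cone /line_of_point /coord3 /=.
- by rewrite rmorphD /= ev_const ev_s comp_polyX addrC.
- rewrite rmorphD rmorphM /= ev_const ev_s ev_t.
  rewrite comp_polyB comp_polyZ comp_polyX comp_polyC scalerDr -!mul_polyC -polyCM.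
  by rewrite -e1 polyCD; ring.
rewrite rmorphD rmorphM rmorphXn /= ev_const ev_s ev_t -polyC_exp.
rewrite comp_polyB comp_polyZ comp_polyX comp_polyC scalerDr -!mul_polyC -polyCM.
have -> : p.1.1 ^+ 2 * l.1.1 = p.1.1 * p.1.2 + p.2 + l.2.
  by rewrite expr2 -mulrA -e1 mulrDr -addrA e2.
by rewrite polyCD; ring.
Qed.

Lemma D_on_cone f : D (on_cone f) = s * (on_cone f`_b + t * on_cone f`_c *+ 2).
Proof.
rewrite {1}/on_cone (mmap_chain _ _ DD DM D_const) sum_coord3 -/(on_cone f`_a) -/(on_cone f`_b) -/(on_cone f`_c) /cone !coord3_inord.
rewrite !DD !D_const !DM D_s D_t.
move: (on_cone _) (on_cone _) (on_cone _) => x y z.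
ring.
Qed.

(** The direction (0, 1, 2 t) itself moves: its derivative (0, 0, 2) produces the term with one
    factor [s] less. *)
Lemma D2_on_cone f : D (D (on_cone f)) =
  s * (s * (on_cone f`_b`_b + t * on_cone f`_b`_c *+ 4 + t ^+ 2 * on_cone f`_c`_c *+ 4)
        + on_cone f`_c *+ 2).
Proof.
rewrite D_on_cone DM D_s mul0r add0r DD !mulr2n !DD !DM D_t !D_on_cone.
rewrite (mderiv_comm (inord 1) (inord 2)).
move: (on_cone _) (on_cone _) (on_cone _) (on_cone _) => x y z w.
ring.
Qed.

Lemma D_on_cone_at f : ev (D (on_cone f)) = 'X * (normal_deriv p f \Po ('X + l.1.1%:P)).
Proof.
rewrite D_on_cone rmorphM ev_s rmorphD rmorphMn rmorphM /= !on_cone_at ev_t.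
by rewrite /normal_deriv comp_polyD comp_polyZ -mul_polyC polyCMn mulrnAl.
Qed.

Let comp_pencil (a : K) (x w q : {poly K}) : q = 'X + a%:P ->
  (('X - a%:P) * x + w *+ 2) \Po q = 'X * (x \Po q) + (w \Po q) *+ 2.
Proof.
move=> ->; rewrite comp_polyD comp_polyM comp_polyB comp_polyX comp_polyC addrK.
by rewrite mulr2n comp_polyD -mulr2n.
Qed.

Lemma D2_on_cone_at f : ev (D (D (on_cone f))) = 'X *
  ((('X - l.1.1%:P) * normal_deriv2 p f + on_line_of p f`_c *+ 2) \Po ('X + l.1.1%:P)).
Proof.
rewrite D2_on_cone comp_pencil //.
rewrite !(rmorphD, rmorphM, rmorphMn, rmorphXn) /= !on_cone_at ev_s ev_t.
congr (_ * (_ * _ + _)).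
rewrite !comp_polyZ -!mul_polyC -polyC_exp.
by rewrite !polyCMn !mulrnAl.
Qed.

End Cone.

Section NullLines.

Variable K : fieldType.
Implicit Types (p l : K * K * K) (P L : seq (K * K * K)) (f : {mpoly K[3]}).

(* {poly {poly K}} is K[t][s], with s the outer variable. *)
Let const : {rmorphism K -> {poly {poly K}}} := (@polyC {poly K} \o @polyC K).
Let t : {poly {poly K}} := 'X%:P.
Let dt (q : {poly {poly K}}) : {poly {poly K}} := map_poly (@deriv K) q.
Let ev (c : K) : {rmorphism {poly {poly K}} -> {poly K}} := map_poly (horner_eval c).

Let coef_dt q j : (dt q)`_j = (q`_j)^`().
Proof. by rewrite coef_map. Qed.

Let dtD a b : dt (a + b) = dt a + dt b.
Proof. by apply/polyP => j; rewrite !(coef_dt, coefD) derivD. Qed.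

Let dtM a b : dt (a * b) = dt a * b + a * dt b.
Proof.
apply/polyP => j; rewrite coef_dt coefD !coefM raddf_sum -big_split /=.
by apply: eq_bigr => i _; rewrite derivM !coef_dt.
Qed.

Let dt_const c : dt (const c) = 0.
Proof. by apply/polyP => j; rewrite coef_dt coef0 /= coefC; case: eqP; rewrite ?derivC ?deriv0. Qed.

Let dtX : dt 'X = 0.
Proof.
by apply/polyP => j; rewrite coef_dt coef0 /= coefX; case: eqP; rewrite ?derivC ?deriv0 // -polyC1 derivC.
Qed.

Let dt_t : dt t = 1.
Proof. by apply/polyP => j; rewrite coef_dt /t coefC coef1; case: eqP; rewrite ?derivX ?deriv0. Qed.

Let ev_const c a : ev c (const a) = a%:P.
Proof. by rewrite /= map_polyC /= horner_evalE hornerC. Qed.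

Let ev_X c : ev c 'X = 'X. Proof. exact: map_polyX. Qed.

Let ev_t c : ev c t = c%:P.
Proof. by rewrite /= map_polyC /= horner_evalE hornerX. Qed.

Let coef_ev c q j : (ev c q)`_j = (q`_j).[c].
Proof. by rewrite coef_map. Qed.

Let Phi l f := on_cone const 'X t l f.

(** Along the cone, t enters only through s t and s t^2, so each power of s brings at most two
    powers of t; sums and products preserve this. *)
Lemma size_coef_on_cone l f j : (size ((Phi l f)`_j)%R <= j.*2.+1)%N.
Proof.
move: j; apply: (@mmap_ind _ _ _ _ (fun q : {poly {poly K}} => forall j, (size (q`_j)%R <= j.*2.+1)%N)).
- by move=> c j; rewrite /= coefC; case: eqP => _; rewrite ?size_poly0 // (leq_trans (size_polyC_leq1 _)).
- have lin (c : K) (k : nat) j : (k <= 2)%N ->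
      (size ((const c + 'X * t ^+ k)`_j)%R <= j.*2.+1)%N.
    move=> k2; rewrite /t -rmorphXn /= coefD coefC mulrC coefCM coefX.
    case: j => [|[|j]] /=; rewrite ?mulr0 ?addr0 ?add0r ?mulr1 ?size_poly0 //.
      by rewrite (leq_trans (size_polyC_leq1 _)).
    by rewrite size_polyXn.
  case=> [[|[|[|[]]]] hi] //= j; rewrite /cone /coord3 /=.
  + by have := lin l.1.1 0%N j; rewrite expr0 mulr1; apply.
  + by have := lin l.1.2 1%N j; rewrite expr1; apply.
  by have := lin l.2 2%N j; apply.
- move=> a b ha hb j; rewrite coefD; apply: (leq_trans (size_polyD _ _)).
  by rewrite geq_max ha hb.
move=> a b ha hb j; rewrite coefM; apply: (leq_trans (size_sum _ _ _)).
apply/bigmax_leqP => i _; apply: (leq_trans (size_polyMleq _ _)).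
have := ha i; have := hb (j - i)%N; have := ltn_ord i.
move: (size (a`_i)%R) (size (b`_(j - i))%R) (nat_of_ord i) => x y z.
lia.
Qed.

Section OneCone.

Variables (P : seq (K * K * K)) (l : K * K * K) (f : {mpoly K[3]}).
Hypothesis Puniq : uniq P.
Hypothesis f0 : {in P, forall p, on_line_of p f = 0}.

Let k := count (fun p => incident p l) P.
Let ts := [seq p.1.1 | p <- P & incident p l].

Let ts_uniq : uniq ts.
Proof.
rewrite map_inj_in_uniq ?filter_uniq // => p p'.
rewrite !mem_filter => /andP[pl _] /andP[p'l _].
exact: incident_point_inj pl p'l.
Qed.

Let Phi_root j c : c \in ts -> root (Phi l f)`_j c.
Proof.
case/mapP => p; rewrite mem_filter => /andP[pl pP] ->.
rewrite rootE -coef_ev (on_cone_at pl (ev_const _) (ev_X _) (ev_t _)).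
by rewrite f0 // comp_poly0 coef0.
Qed.

(** On the cone the coefficient of s^j has degree at most 2 j in t and a root for each of the k
    points on [l]; for 2 j < k it is zero, and so is its t-derivative. *)
Lemma dvdp_normal_deriv p : incident p l ->
  ('X - l.1.1%:P) ^+ (uphalf k).-1 %| normal_deriv p f.
Proof.
move=> pl; apply: dvdp_shift => j jk.
(* The t-derivative on the cone carries a factor s, so coefficient [j] is read at [j.+1]. *)
rewrite -[LHS](_ : ('X * (normal_deriv p f \Po ('X + l.1.1%:P)))`_j.+1 = _); last by rewrite coefXM.
rewrite -(D_on_cone_at dtD dtM dt_const dtX dt_t pl (ev_const _) (ev_X _) (ev_t _)).
rewrite coef_ev coef_dt (_ : _`_j.+1 = 0) ?deriv0 ?horner0 //.
apply: (@size_horner_roots _ _ ts ts_uniq); first by apply/allP => c; apply: Phi_root.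
apply: (leq_trans (size_coef_on_cone _ _ _)); rewrite size_map size_filter -/k.
lia.
Qed.

Hypothesis Df0 : {in P, forall p, normal_deriv p f = 0}.

(** Zero normal derivatives make every root in t double: counted so, 2 k roots kill the coefficients
    of s^j for all j < k, about twice as many as before. *)
Lemma dvdp_pencil p : incident p l ->
  ('X - l.1.1%:P) ^+ k.-1 %| ('X - l.1.1%:P) * normal_deriv2 p f + on_line_of p f`_c *+ 2.
Proof.
move=> pl; apply: dvdp_shift => j jk.
rewrite -[LHS](_ : ('X * ((('X - l.1.1%:P) * normal_deriv2 p f + on_line_of p f`_c *+ 2)
  \Po ('X + l.1.1%:P)))`_j.+1 = _); last by rewrite coefXM.
rewrite -(D2_on_cone_at dtD dtM dt_const dtX dt_t pl (ev_const _) (ev_X _) (ev_t _)).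
rewrite coef_ev !coef_dt (_ : _`_j.+1 = 0) ?deriv0 ?horner0 //.
apply: (@multiple_roots_eq0 K K ts id (fun=> 2%N) ((Phi l f)`_j.+1)); rewrite ?map_id //.
- move=> c cts; apply: double_root_dvdp; first exact: Phi_root.
  case/mapP: cts => p'; rewrite mem_filter => /andP[p'l p'P] ->.
  rewrite rootE -coef_dt -coef_ev.
  rewrite (D_on_cone_at dtD dtM dt_const dtX dt_t p'l (ev_const _) (ev_X _) (ev_t _)).
  by rewrite Df0 // comp_poly0 mulr0 coef0.
apply: leq_trans (size_coef_on_cone _ _ _) _.
rewrite big_const_seq count_predT iter_addn_0 size_map size_filter -/k.
lia.
Qed.

End OneCone.

End NullLines.

Section RichLines.

Variables (K : fieldType) (P L : seq (K * K * K)) (d M : nat).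
Hypothesis Puniq : uniq P.
Hypothesis Luniq : uniq L.
Let deg (l : K * K * K) := count (fun p => incident p l) P.
Hypothesis deg_le : {in L, forall l, (deg l <= M)%N}.
Hypothesis Prich : {in P, forall p, (2 * d + M <= \sum_(l <- L | incident p l) (deg l - 2))%N}.
Hypothesis d_gt1 : (1 < d)%N.
Hypothesis char_gt : forall i, (0 < i <= d)%N -> i%:R != 0 :> K.

Let Lp p := [seq l <- L | incident p l].

Let Lp_uniq p : uniq [seq l.1.1 | l <- Lp p].
Proof.
rewrite map_inj_in_uniq ?filter_uniq // => l l'.
rewrite !mem_filter => /andP[pl _] /andP[pl' _].
exact: incident_line_inj pl pl'.
Qed.

Let Lp_le p : p \in P -> (2 * d + M <= \sum_(l <- Lp p) (deg l - 2))%N.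
Proof. by move=> pP; rewrite big_filter; apply: Prich. Qed.

Let size_on_line_of (p : K * K * K) (g : {mpoly K[3]}) k : (msize g <= k)%N -> (size (on_line_of p g) <= k)%N.
Proof. by apply: size_mmap_le; apply: size_line_of_point. Qed.

Let size_addZ (a b : {poly K}) c :
  (size a <= d)%N -> (size b <= d)%N -> (size (a + c *: b)%R <= d)%N.
Proof.
move=> sa sb; apply: (leq_trans (size_polyD _ _)); rewrite geq_max sa.
exact: leq_trans (size_scale_leq _ _) sb.
Qed.

Implicit Types (p l : K * K * K) (f : {mpoly K[3]}).

(** Along the null line the orders [(uphalf (deg l)).-1] sum to at least half of [2 * d + M], hence
    to the bound [d] on the size. *)
Lemma normal_deriv_eq0 f : (msize f <= d.+1)%N -> {in P, forall p, on_line_of p f = 0} ->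
  {in P, forall p, normal_deriv p f = 0}.
Proof.
move=> fd f0 p pP.
apply: (@multiple_roots_eq0 _ _ (Lp p) (fun l => l.1.1) (fun l => (uphalf (deg l)).-1)).
- exact: Lp_uniq.
- move=> l; rewrite mem_filter => /andP[pl _].
  exact: dvdp_normal_deriv.
apply: (@leq_trans d).
  by apply: size_addZ; apply/size_on_line_of/msize_mderiv.
rewrite -leq_double -mul2n; apply: (leq_trans (leq_addr M _)); apply: (leq_trans (Lp_le pP)).
rewrite -mul2n big_distrr /=; apply: leq_sum => l _; lia.
Qed.

Lemma mderiv_c_eq0 f : (msize f <= d.+1)%N -> {in P, forall p, on_line_of p f = 0} ->
  {in P, forall p, on_line_of p f`_c = 0}.
Proof.
move=> fd f0 p pP; have Df0 := normal_deriv_eq0 fd f0.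
have sd i : (msize (mderiv i f) <= d)%N by apply: msize_mderiv.
have sd2 i j : (msize (mderiv j (mderiv i f)) <= d)%N.
  by apply: msize_mderiv; apply: leqW.
apply: (@pencil_eq0 _ _ (Lp p) (fun l => l.1.1) deg (normal_deriv2 p f) _ d M) => //.
- by rewrite !size_addZ // size_on_line_of.
- exact: size_on_line_of.
- move=> l; rewrite mem_filter => /andP[pl _].
  exact: dvdp_pencil.
- by move=> l; rewrite mem_filter => /andP[_ lL]; apply: deg_le.
exact: Lp_le.
Qed.

(* Along a null line p the tangent plane of the surface f = 0 is forced to contain first the
   normal direction (0, 1, 2 p1) and then (0, 0, 1): the surface is singular along p. *)
Lemma gradient_eq0 f : (msize f <= d.+1)%N -> {in P, forall p, on_line_of p f = 0} ->
  forall i, {in P, forall p, on_line_of p (mderiv i f) = 0}.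
Proof.
move=> fd f0 i p pP.
have c0 := mderiv_c_eq0 fd f0 pP.
have b0 : on_line_of p f`_b = 0.
  by have := normal_deriv_eq0 fd f0 pP; rewrite /normal_deriv c0 scaler0 addr0.
(* The derivative of [f] along the null line, in the direction (1, p1, p1^2), is zero. *)
have a0 : on_line_of p f`_a = 0.
  have := @mmap_chain 3 K {poly K} (@polyC K) (@deriv K) (line_of_point p) f
    (@derivD _) (@derivM _) (@derivC _).
  rewrite -/(on_line_of p f) f0 // deriv0 sum_coord3.
  rewrite -/(on_line_of p f`_a) -/(on_line_of p f`_b) -/(on_line_of p f`_c).
  by rewrite b0 c0 /line_of_point !coord3_inord derivX !mul0r mulr1 !addr0.
have [->|->|->] // : [\/ i = inord 0, i = inord 1 | i = inord 2].
by case: i => [[|[|[|[]]]] hi] //; [apply: Or31|apply: Or32|apply: Or33];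
  apply: val_inj; rewrite /= inordK.
Qed.

(** By [gradient_eq0] the partial derivatives vanish on the same null lines and have smaller degree;
    by induction they are zero, and [f] is a constant with a zero. *)
Lemma vanishes_on_null_lines_eq0 f : P != [::] -> (msize f <= d.+1)%N ->
  {in P, forall p, on_line_of p f = 0} -> f = 0.
Proof.
move=> Pn0; have [p0 p0P] : exists p, p \in P.
  by case: P Pn0 => // p *; exists p; apply: mem_head.
suff H k : (k <= d.+1)%N -> forall g, (msize g <= k)%N ->
    {in P, forall p, on_line_of p g = 0} -> g = 0 by apply: H.
elim: k => [|k IH] kd g gk g0.
  by apply/eqP; rewrite -msize_poly_eq0 -leqn0.
have gd : (msize g <= d.+1)%N by apply: leq_trans kd.
have gC : g = (g@_0)%:MP.
  apply: (mderiv_eq0_const char_gt gd) => i.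
  by apply: IH (ltnW kd) _ (msize_mderiv _ gk) _; apply: gradient_eq0.
have /eqP := g0 _ p0P; rewrite gC /on_line_of mmapC polyC_eq0 => /eqP ->.
by rewrite mpolyC0.
Qed.

End RichLines.

(** * Pruning and elementary counting *)

Lemma pruning (T U : eqType) (inc : T -> U -> bool) (w : nat -> nat) (X : seq U) (B : nat)
    (S : seq T) :
  uniq S ->
  (forall S', uniq S' -> {subset S' <= S} -> S' != [::] ->
     exists2 s, s \in S' & (\sum_(x <- X | inc s x) w (count (inc^~ x) S') <= B)%N) ->
  (\sum_(x <- X) \sum_(j < count (inc^~ x) S) w j.+1 <= size S * B)%N.
Proof.
have [N] := ubnP (size S); elim: N S => // N IH S SN uS H.
have [->|S0] := eqVneq S [::].
  by rewrite /= big1 // => x _; rewrite big_ord0.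
have [s sS sB] := H S uS (fun x => id) S0.
have cE x : count (inc^~ x) S = (inc s x + count (inc^~ x) (rem s S))%N.
  by rewrite (permP (perm_to_rem sS)).
have sz : (0 < size S)%N by rewrite lt0n size_eq0.
have -> : (size S = (size (rem s S)).+1)%N by rewrite size_rem // prednK.
rewrite mulSn.
(* Removing the cheap element [s] lowers the count at each incident [x] by one and deletes exactly
   its last term; these terms together cost at most [B]. *)
have E : (\sum_(x <- X) \sum_(j < count (inc^~ x) S) w j.+1 =
    \sum_(x <- X | inc s x) w (count (inc^~ x) S)
    + \sum_(x <- X) \sum_(j < count (inc^~ x) (rem s S)) w j.+1)%N.
  rewrite [X in (_ = X + _)%N]big_mkcond -big_split /=; apply: eq_bigr => x _.
  rewrite cE; case: (inc s x) => //.
  by rewrite add1n big_ord_recr addnC.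
rewrite E; apply: leq_add => //; apply: IH.
- by rewrite size_rem //; move: sz SN; lia.
- exact: rem_uniq.
move=> S' uS' sub; apply: H => // x /sub; exact: mem_rem.
Qed.

Lemma cauchy_schwarz_nat (T : Type) (s : seq T) (a : T -> nat) :
  ((\sum_(x <- s) a x) ^ 2 <= size s * \sum_(x <- s) a x ^ 2)%N.
Proof.
elim: s => [|x s IH]; first by rewrite !big_nil.
rewrite !big_cons /=.
have cross : (2 * (a x * \sum_(y <- s) a y) <= size s * a x ^ 2 + \sum_(y <- s) a y ^ 2)%N.
  elim: s {IH} => [|y s IH]; first by rewrite !big_nil muln0.
  rewrite !big_cons mulnDr mulnDr /= [((size s).+1 * _)%N]mulSn addnACA leq_add //.
  exact: nat_Cauchy.
rewrite sqrnD [((size s).+1 * _)%N]mulSn mulnDr.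
move: IH cross.
move: (size s * a x ^ 2)%N (size s * _)%N (2 * _)%N => A B C.
move: (a x ^ 2)%N ((\sum_(j <- s) a j) ^ 2)%N (\sum_(j <- s) a j ^ 2)%N => D E F.
lia.
Qed.

Lemma exists_sqrt (N : nat) : (1 < N)%N ->
  exists e, [/\ (0 < e)%N, (e ^ 2 < N)%N & (N <= e.+1 ^ 2)%N].
Proof.
move=> N1; have ex : exists e, (N <= e.+1 ^ 2)%N by exists N; nia.
exists (ex_minn ex); case: ex_minnP => e Ne emin; split=> //.
  by case: e Ne {emin} => //; rewrite exp1n; lia.
case: e Ne emin => [|e] Ne emin; first by lia.
rewrite ltnNge; apply/negP => le; have := emin e le; lia.
Qed.

Lemma natr_neq0_of_pchar (K : fieldType) (d : nat) :
  (forall q, q \in [pchar K] -> (d < q)%N) -> forall i, (0 < i <= d)%N -> i%:R != 0 :> K.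
Proof.
move=> H i /andP[i0 id]; apply/negP => iK.
have [q qK] := natf0_pchar i0 iK.
have : (q %| i)%N by rewrite (dvdn_pcharf qK).
move/(dvdn_leq i0) => qi; have := H q qK; lia.
Qed.

(** * Weighted counts of rich points, rich lines and heavy lines *)

Section Bounds.

Variable K : fieldType.
Implicit Types (P L : seq (K * K * K)).

(** Pruning with weight 1 for points on two remaining lines: if every remaining line carried more
    than 3 e of them, the vanishing polynomial of degree at most 3 e would be zero. *)
Lemma sum_rich_points P L e :
  uniq P -> uniq L -> (0 < e)%N -> (3 * size L <= e.+1 ^ 2)%N ->
  (forall i, (0 < i <= 3 * e)%N -> i%:R != 0 :> K) ->
  (\sum_(p <- P) (count (incident p) L).-1 <= size L * (3 * e))%N.
Proof.
move=> uP uL e0 le ch.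
have -> : (\sum_(p <- P) (count (incident p) L).-1 =
    \sum_(p <- P) \sum_(j < count (fun l => incident p l) L) (1 < j.+1))%N.
  apply: eq_bigr => p _; elim: (count _ _) => [|[|k] IH]; first by rewrite big_ord0.
    by rewrite big_ord1.
  by rewrite big_ord_recr /= -IH addn1.
apply: (pruning (inc := fun l p => incident p l) (w := fun j => nat_of_bool (1 < j)%N)) => //.
move=> L' uL' sub L'0; set d := (3 * e)%N in ch *.
have sL : (size L' <= size L)%N by apply: uniq_leq_size.
case: (@exists_vanishing 3 e K _ L' (@point_line K) (@size_point_line K)).
  (* Since 3 e + 1 < 3 (e + 1), the number of conditions stays below [e.+1 ^ 3]. *)
  have : (size L' * 3 <= e.+1 ^ 2)%N by lia.
  have : (0 < size L')%N by rewrite lt0n size_eq0.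
  move: (size L') => k; nia.
move=> f [f0 fd fL].
have [/hasP[l lL' lB]|no] := boolP (has (fun l =>
    \sum_(p <- P | incident p l) (1 < count (incident p) L') <= d)%N L').
  by exists l.
case/eqP: f0; apply: (@vanishes_on_rich_lines_eq0 K P L' d uP uL') => //; last by rewrite /d; lia.
move=> l lL'; move/hasPn/(_ l lL'): no; rewrite -ltnNge => /leq_trans; apply.
rewrite -sum1_count big_mkcond [X in (_ <= X)%N]big_mkcond /=.
by apply: leq_sum => p _; case: (incident p l).
Qed.

(** Pruning with the weight [j - 2] of [vanishes_on_null_lines_eq0], which provides a cheap point in
    every nonempty subset. *)
Lemma sum_rich_lines P L e M :
  uniq P -> uniq L -> (0 < e)%N -> (3 * size P <= e.+1 ^ 2)%N ->
  (forall i, (0 < i <= 3 * e)%N -> i%:R != 0 :> K) ->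
  {in L, forall l, (count (fun p => incident p l) P <= M)%N} ->
  (\sum_(l <- L) \sum_(j < count (fun p => incident p l) P) (j.+1 - 2) <= size P * (2 * (3 * e) + M))%N.
Proof.
move=> uP uL e0 le ch PM.
apply: (pruning (inc := fun p l => incident p l) (w := fun j => (j - 2)%N)) => //.
move=> P' uP' sub P'0; set d := (3 * e)%N in ch *.
have sP : (size P' <= size P)%N by apply: uniq_leq_size.
case: (@exists_vanishing 3 e K _ P' (@line_of_point K) (@size_line_of_point K)).
  have : (size P' * 3 <= e.+1 ^ 2)%N by lia.
  have : (0 < size P')%N by rewrite lt0n size_eq0.
  move: (size P') => k; nia.
move=> f [f0 fd fP].
have [/hasP[p pP' pB]|no] := boolP (has (fun p =>
    \sum_(l <- L | incident p l) (count (fun p => incident p l) P' - 2) <= 2 * d + M)%N P').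
  by exists p.
case/eqP: f0; apply: (@vanishes_on_null_lines_eq0 K P' L d M uP' uL) => //; last by rewrite /d; lia.
- move=> l lL; apply: leq_trans (PM l lL); rewrite -!size_filter.
  apply: uniq_leq_size; first exact: filter_uniq.
  by move=> p; rewrite !mem_filter => /andP[-> /sub ->].
by move=> p pP'; move/hasPn/(_ p pP'): no; rewrite -ltnNge => /ltnW.
Qed.

(** The first incidence equations of two common points combine to (p1 - p1')(l1 - l1') = 0. *)
Lemma two_lines_meet_once P (l l' : K * K * K) : uniq P -> l != l' ->
  (count (fun p => incident p l && incident p l') P <= 1)%N.
Proof.
move=> uP ll'; rewrite -size_filter; case E: [seq _ <- _ | _] => [|p [|p' s]] //.
have H x : x \in [:: p, p' & s] -> incident x l && incident x l'.
  by rewrite -E mem_filter => /andP[].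
have /andP[pl pl'] := H p (mem_head _ _).
have /andP[ql ql'] : incident p' l && incident p' l' by apply: H; rewrite !inE eqxx orbT.
have : uniq [:: p, p' & s] by rewrite -E filter_uniq.
suff -> : p = p' by rewrite /= mem_head.
have l1 : l.1.1 != l'.1.1 by apply: contraNneq ll' => e; rewrite (incident_line_inj pl pl' e).
apply: (incident_point_inj pl ql).
case/andP: pl ql pl' ql' => /eqP e1 _ /andP[/eqP e2 _] /andP[/eqP e3 _] /andP[/eqP e4 _].
have /eqP : (p.1.1 - p'.1.1) * (l.1.1 - l'.1.1) = 0.
  by rewrite mulrBl !mulrBr -e1 -e2 -e3 -e4; ring.
by rewrite mulf_eq0 !subr_eq0 (negPf l1) orbF => /eqP.
Qed.

Lemma double_count (T U : Type) (inc : T -> U -> bool) (s : seq T) (r : seq U) :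
  (\sum_(x <- s) count (inc x) r = \sum_(y <- r) count (inc^~ y) s)%N.
Proof.
under eq_bigr do rewrite -sum1_count big_mkcond.
rewrite exchange_big; apply: eq_bigr => y _ /=.
by rewrite -big_mkcond sum1_count.
Qed.

(** Second moment: for N lines, m points and I incidences, I^2 <= m (I + N^2), while N M <= I and 12
    m <= M^2 give m N^2 <= I^2 / 12. *)
Lemma few_heavy_lines P L M :
  uniq P -> uniq L -> (12 * size P <= M ^ 2)%N ->
  {in L, forall l, (M <= count (fun p => incident p l) P)%N} ->
  (\sum_(l <- L) count (fun p => incident p l) P <= 2 * size P)%N.
Proof.
move=> uP uL hM heavy.
set I := (\sum_(l <- L) _)%N.
have IE : I = (\sum_(p <- P) count (incident p) L)%N by rewrite double_count.
have NM : (size L * M <= I)%N.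
  have -> : (size L * M = \sum_(l <- L) M)%N by rewrite big_const_seq count_predT iter_addn_0 mulnC.
  rewrite /I big_seq [X in (_ <= X)%N]big_seq.
  by apply: leq_sum => l lL; apply: heavy.
(* The square counts pairs of lines through [p]: equal pairs contribute [I], and distinct lines
   share at most one point. *)
have sq : (\sum_(p <- P) count (incident p) L ^ 2 <= I + size L ^ 2)%N.
  have -> : (\sum_(p <- P) count (incident p) L ^ 2 =
     \sum_(l <- L) \sum_(p <- P | incident p l) count (incident p) L)%N.
    under [RHS]eq_bigr do rewrite big_mkcond.
    rewrite exchange_big; apply: eq_bigr => p _ /=.
    by rewrite -big_mkcond big_const_seq iter_addn_0 mulnn.
  have -> : (size L ^ 2 = \sum_(l <- L) size L)%N.
    by rewrite big_const_seq count_predT iter_addn_0 mulnn.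
  rewrite /I -big_split /= big_seq [X in (_ <= X)%N]big_seq; apply: leq_sum => l lL.
  have -> : (\sum_(p <- P | incident p l) count (incident p) L =
      \sum_(l' <- L) count (fun p => incident p l && incident p l') P)%N.
    rewrite -double_count big_mkcond /=; apply: eq_bigr => p _.
    by case: (incident p l) => //; rewrite count_pred0.
  rewrite (bigD1_seq l) //=; apply: leq_add.
    by apply: eq_leq; apply: eq_count => p; rewrite andbb.
  have -> : (size L = \sum_(l' <- L) 1)%N by rewrite big_const_seq count_predT iter_addn_0 mul1n.
  rewrite big_mkcond; apply: leq_sum => l' _; case: eqVneq => //= ll'.
  by apply: two_lines_meet_once => //; rewrite eq_sym.
have := cauchy_schwarz_nat P (fun p => count (incident p) L); rewrite -IE.
move: sq NM hM; move: (\sum_(p <- P) _)%N (size P) (size L) => Q m N.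
nia.
Qed.

End Bounds.

(** * Choice of parameters *)

Section Assembly.

Variable K : fieldType.
Implicit Types (P L : seq (K * K * K)).

Theorem point_line_bound P L :
  uniq P -> uniq L -> (forall q, q \in [pchar K] -> (size L ^ 3 <= q ^ 4)%N) ->
  exists J, (\sum_(p <- P) count (incident p) L <= 1000 * size P + 2 * size L + J)%N /\
    (J ^ 4 <= 1200 * size L ^ 2 * size P ^ 3)%N.
Proof.
move=> uP uL ch.
have [n1000|n1000] := leqP (size L) 1000.
  exists 0%N; split=> //; rewrite addn0; apply: leq_trans (leq_addr _ _).
  have -> : (1000 * size P = \sum_(p <- P) 1000)%N.
    by rewrite big_const_seq count_predT iter_addn_0.
  by apply: leq_sum => p _; apply: leq_trans (count_size _ _) _.
have [e [e0 eN Ne]] := @exists_sqrt (3 * size L)%N ltac:(lia).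
(* Otherwise n^3 <= q^4 <= (9 e^2)^2 <= (27 n)^2 for n = [size L], so n <= 729, contrary to
   [n1000]. *)
have ch1 q : q \in [pchar K] -> (3 * e < q)%N.
  move=> /ch qn; rewrite ltnNge; apply/negP => qe.
  have q2 : (q ^ 2 <= 9 * e ^ 2)%N by rewrite (_ : 9 = 3 ^ 2)%N // -expnMn leq_exp2r.
  have : (q ^ 4 <= (27 * size L) ^ 2)%N.
    rewrite (_ : 4 = 2 * 2)%N // expnM leq_exp2r //; lia.
  move: n1000 qn; move: (q ^ 4)%N (size L) => x n; clear; nia.
have A := sum_rich_points uP uL e0 Ne (natr_neq0_of_pchar ch1).
(* The threshold 141 makes 27 * size P1 smaller than the square of the characteristic. *)
pose P1 := [seq p <- P | (141 < count (incident p) L)%N].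
have uP1 : uniq P1 by apply: filter_uniq.
have sP1 : (size P1 <= size P)%N by rewrite size_filter count_size.
have m1n : (141 * size P1 <= 3 * size L * e)%N.
  rewrite (_ : 3 * size L * e = size L * (3 * e))%N; last by rewrite mulnAC mulnC.
  apply: leq_trans A.
  have -> : (141 * size P1 = \sum_(p <- P1) 141)%N.
    by rewrite big_const_seq count_predT iter_addn_0.
  rewrite big_filter big_mkcond /=; apply: leq_sum => p _; case: ifP => //.
  by case: (count _ _).
have split1 : (\sum_(p <- P) count (incident p) L <=
    141 * size P + \sum_(p <- P1) count (incident p) L)%N.
  have -> : (141 * size P = \sum_(p <- P) 141)%N.
    by rewrite big_const_seq count_predT iter_addn_0.
  rewrite big_filter [X in (_ <= _ + X)%N]big_mkcond -big_split /=.
  apply: leq_sum => p _; case: (ltnP 141) => [_|]; first exact: leq_addl.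
  by rewrite addn0.
have [P10|m1] := posnP (size P1).
  exists 0%N; split=> //; rewrite addn0; apply: leq_trans split1 _.
  rewrite (size0nil P10) big_nil; lia.
have [e1 [e10 eN1 Ne1]] := @exists_sqrt (3 * size P1)%N ltac:(lia).
have ch2 q : q \in [pchar K] -> (3 * e1 < q)%N.
  move=> /ch qn; rewrite ltnNge; apply/negP => qe.
  have q2 : (q ^ 2 <= 9 * e1 ^ 2)%N by rewrite (_ : 9 = 3 ^ 2)%N // -expnMn leq_exp2r.
  have q4 : (q ^ 4 <= (27 * size P1) ^ 2)%N.
    rewrite (_ : 4 = 2 * 2)%N // expnM leq_exp2r //; lia.
  (* As 27^3 < 141^2, [q4] and [m2] contradict [qn]. *)
  have m2 : (141 ^ 2 * size P1 ^ 2 <= 27 * size L ^ 3)%N.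
    rewrite -expnMn; apply: (@leq_trans ((3 * size L * e) ^ 2)); first by rewrite leq_exp2r.
    rewrite !expnMn; move: eN; move: (e ^ 2)%N (size L) => x n; clear; nia.
  move: n1000 qn q4 m2; rewrite expnMn; move: (size P1 ^ 2)%N (q ^ 4)%N (size L) => x y n; clear.
  move=> n1; have : (0 < n ^ 3)%N by rewrite expn_gt0; lia.
  move: (n ^ 3)%N => z; lia.
(* Large enough for [12 * size P1 <= M ^ 2] in [few_heavy_lines], yet of order [e1], like the degree
   [3 * e1]. *)
pose M := (2 * e1.+1)%N.
pose deg l := count (fun p => incident p l) P1.
pose Lbig := [seq l <- L | (M < deg l)%N]; pose Lsm := [seq l <- L | ~~ (M < deg l)%N].
have Ebig : (\sum_(l <- Lbig) deg l <= 2 * size P1)%N.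
  apply: (few_heavy_lines (M := M)) => //; first exact: filter_uniq.
    rewrite /M expnMn; lia.
  by move=> l; rewrite mem_filter => /andP[/ltnW].
have Esm : (\sum_(l <- Lsm) \sum_(j < deg l) (j.+1 - 2) <= size P1 * (2 * (3 * e1) + M))%N.
  apply: sum_rich_lines => //; first exact: filter_uniq.
    exact: natr_neq0_of_pchar.
  by move=> l; rewrite mem_filter -leqNgt => /andP[].
pose J := (\sum_(l <- Lsm) (deg l - 2))%N.
have sLsm : (size Lsm <= size L)%N by rewrite size_filter count_size.
(* Cauchy-Schwarz, with (k - 2)^2 at most twice the sum of the weights [j.+1 - 2] over j < k. *)
have J2 : (J ^ 2 <= size L * (2 * (size P1 * (2 * (3 * e1) + M))))%N.
  apply: (leq_trans (cauchy_schwarz_nat _ _)); apply: leq_mul => //.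
  apply: leq_trans (leq_mul (leqnn 2) Esm).
  rewrite big_distrr /=; apply: leq_sum => l _.
  elim: (deg l) => [|k IH] //; rewrite big_ord_recr /= mulnDr.
  move: IH; move: (\sum_(i < k) _)%N => S; nia.
exists J; split.
  apply: leq_trans split1 _; rewrite double_count.
  have -> : (\sum_(l <- L) deg l = \sum_(l <- Lbig) deg l + \sum_(l <- Lsm) deg l)%N.
    by rewrite (bigID (fun l => (M < deg l)%N)) /= !big_filter.
  have : (\sum_(l <- Lsm) deg l <= J + 2 * size L)%N.
    apply: (@leq_trans (J + \sum_(l <- Lsm) 2)).
      by rewrite -big_split /=; apply: leq_sum => l _; lia.
    by rewrite leq_add2l big_const_seq count_predT iter_addn_0 leq_mul2l sLsm.
  move: Ebig sP1; move: (\sum_(l <- Lbig) _)%N (\sum_(l <- Lsm) _)%N J {J2} (size P1) (size P) (size L).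
  clear; lia.
(* As e1 >= 1, 2 (6 e1 + M) <= 20 e1; below, e1^2 < 3 [size P1] turns 20^2 into 1200. *)
have J4 : (J ^ 4 <= (20 * size L * size P1 * e1) ^ 2)%N.
  rewrite (_ : 4 = 2 * 2)%N // expnM leq_exp2r //; apply: leq_trans J2 _.
  rewrite /M; move: (size L) (size P1) => n m; clear -e10; nia.
apply: leq_trans J4 _; rewrite !expnMn.
apply: (@leq_trans (20 ^ 2 * size L ^ 2 * size P1 ^ 2 * (3 * size P1))).
  by rewrite leq_mul2l ltnW ?orbT.
apply: (@leq_trans (1200 * size L ^ 2 * size P1 ^ 3)).
  rewrite (expnS _ 2) (_ : 20 ^ 2 = 400)%N //.
  by move: (size L ^ 2)%N (size P1 ^ 2)%N (size P1) => x y z; clear; lia.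
by rewrite leq_mul2l leq_exp2r ?sP1 ?orbT.
Qed.

End Assembly.

(** * Coordinates adapted to the complex *)

Section Coordinates.

Variables (F K : fieldType) (iota : {rmorphism F -> K}).
Implicit Types (q : 'rV[F]_3) (l : 'rV[F]_3 * 'rV[F]_3).

Definition form (u : 'rV[K]_3) q : K := dot3 u (map_mx iota q).

Definition cross (u w : 'rV[K]_3) : 'rV[K]_3 :=
  let x (v : 'rV[K]_3) i := v 0 (inord i) in
  \row_(k < 3) coord3 (x u 1%N * x w 2%N - x u 2%N * x w 1%N) (x u 2%N * x w 0%N - x u 0%N * x w 2%N)
    (x u 0%N * x w 1%N - x u 1%N * x w 0%N) k.

Lemma formE u q : form u q = u 0 (inord 0) * iota (q 0 (inord 0))
  + u 0 (inord 1) * iota (q 0 (inord 1)) + u 0 (inord 2) * iota (q 0 (inord 2)).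
Proof. by rewrite /form /dot3 sum_coord3 !mxE. Qed.

Lemma formD u q q' : form u (q + q') = form u q + form u q'.
Proof. by rewrite !formE !mxE !rmorphD; ring. Qed.

Lemma formB u q q' : form u (q - q') = form u q - form u q'.
Proof. by rewrite !formE !mxE !rmorphB; ring. Qed.

Lemma formZ u (c : F) q : form u (c *: q) = iota c * form u q.
Proof. by rewrite !formE !mxE !rmorphM; ring. Qed.

Lemma crossE u w : (cross u w 0 (inord 0) = u 0 (inord 1) * w 0 (inord 2) - u 0 (inord 2) * w 0 (inord 1))
  * (cross u w 0 (inord 1) = u 0 (inord 2) * w 0 (inord 0) - u 0 (inord 0) * w 0 (inord 2))
  * (cross u w 0 (inord 2) = u 0 (inord 0) * w 0 (inord 1) - u 0 (inord 1) * w 0 (inord 0)).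
Proof. by rewrite !mxE !coord3_inord. Qed.

Lemma row3P (V : Type) (x y : 'rV[V]_3) :
  x 0 (inord 0) = y 0 (inord 0) -> x 0 (inord 1) = y 0 (inord 1) ->
  x 0 (inord 2) = y 0 (inord 2) -> x = y.
Proof.
move=> e0 e1 e2; apply/rowP => i.
have [->|->|->] // : [\/ i = inord 0, i = inord 1 | i = inord 2].
by case: i => [[|[|[|[]]]] hi] //; [apply: Or31|apply: Or32|apply: Or33];
  apply: val_inj; rewrite /= inordK.
Qed.

(** Factoring [m] this way puts the complex in the form of [complex_equation]; a nonzero coordinate
    of [m] gives explicit factors. *)
Lemma exists_cross (m : 'rV[K]_3) : m != 0 -> exists u w, cross u w = m.
Proof.
move=> m0; set x := m 0 (inord 0); set y := m 0 (inord 1); set z := m 0 (inord 2).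
have mk (a b c a' b' c' : K) : b * c' - c * b' = x -> c * a' - a * c' = y ->
    a * b' - b * a' = z -> exists u w, cross u w = m.
  move=> e0 e1 e2; exists (\row_i coord3 a b c i), (\row_i coord3 a' b' c' i).
  by apply: row3P; rewrite !crossE !mxE !coord3_inord.
have [z0|z0] := eqVneq z 0; last first.
  by apply: (mk 1 0 (- x / z) 0 z (- y)); move: x y z z0 {mk} => x y z z0; field.
have [y0|y0] := eqVneq y 0; last first.
  by apply: (mk 0 0 y 1 (- x / y) 0); rewrite ?z0; move: x y y0 {mk} => x y y0; field.
have [x0|x0] := eqVneq x 0; last first.
  by apply: (mk 0 x 0 0 0 1); rewrite ?z0 ?y0; ring.
by case/eqP: m0; apply: row3P; rewrite !mxE.
Qed.

(** For l = (a, d) the Plücker vector is [d : a x d], and Lagrange's identity expands (u x w) . (a x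
    d). *)
Lemma complex_equation (n u w : 'rV[K]_3) l :
  dot3 n (pl_omega iota l) + dot3 (cross u w) (pl_v iota l) =
  form n l.2 + form u l.1 * form w l.2 - form u l.2 * form w l.1.
Proof.
rewrite !formE /dot3 !sum_coord3 /pl_omega /pl_v !mxE !inordK //= !coord3_inord.
rewrite /plk /Defs.hom !inordK //= !mxE !rmorphD.
ring.
Qed.

Section Chart.

Variables (n u w : 'rV[K]_3).
Hypothesis indep : dot3 n (cross u w) != 0.

(** [indep] says that det (n, u, w) is nonzero, and [key] is Cramer's rule. *)
Lemma dot3_eq0 (v : 'rV[K]_3) : dot3 n v = 0 -> dot3 u v = 0 -> dot3 w v = 0 -> v = 0.
Proof.
move=> nv uv wv; have key k :
  v 0 k * dot3 n (cross u w) =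
    dot3 n v * cross u w 0 k + dot3 u v * cross w n 0 k + dot3 w v * cross n u 0 k.
  rewrite /dot3 !sum_coord3.
  have [->|->|->] : [\/ k = inord 0, k = inord 1 | k = inord 2].
    by case: k => [[|[|[|[]]]] hk] //; [apply: Or31|apply: Or32|apply: Or33];
      apply: val_inj; rewrite /= inordK.
  - by rewrite !crossE; ring.
  - by rewrite !crossE; ring.
  by rewrite !crossE; ring.
apply/rowP => k; have /eqP := key k; rewrite nv uv wv !mul0r !addr0 mxE.
by rewrite mulf_eq0 (negPf indep) orbF => /eqP.
Qed.

Lemma dot3_combine (v : 'rV[K]_3) q c d :
  dot3 v (map_mx iota q - c *: map_mx iota d) = form v q - c * form v d.
Proof. by rewrite !formE /dot3 sum_coord3 !mxE; ring. Qed.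

Lemma forms_inj q q' : form n q = form n q' -> form u q = form u q' -> form w q = form w q' ->
  q = q'.
Proof.
move=> en eu ew; apply: (@map_mx_inj _ _ iota); apply/eqP.
rewrite -subr_eq0 -[map_mx _ q']scale1r; apply/eqP.
by apply: dot3_eq0; rewrite dot3_combine mul1r ?en ?eu ?ew subrr.
Qed.

Definition chart_point q : K * K * K := (form u q, form w q, - form n q).

(** [l1] is the slope of [w] against [u]; [l2] and the last coordinate are solved from incidence
    with the base point [l.1]. *)
Definition chart_line l : K * K * K :=
  let l1 := form w l.2 / form u l.2 in
  let l2 := l1 * form u l.1 - form w l.1 in
  (l1, l2, form u l.1 * l2 + form n l.1).

Lemma chart_point_inj : injective chart_point.
Proof.
by move=> q q' [eu ew /oppr_inj en]; apply: forms_inj.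
Qed.

(** By the equation of the complex, - n grows along the line at rate [l2] relative to [u], which is
    the second incidence equation. *)
Lemma chart_incident l q :
  form n l.2 + form u l.1 * form w l.2 - form u l.2 * form w l.1 = 0 ->
  form u l.2 != 0 -> on_line l q = incident (chart_point q) (chart_line l).
Proof.
case: l => a d /= eqn ud; apply/idP/idP => [|].
  case/sub_rVP => c /(canRL (subrK _)) ->.
  rewrite /incident /= !formD !formZ; apply/andP; split; apply/eqP.
    by field.
  have -> : form n d = form u d * form w a - form u a * form w d.
    by apply/eqP; rewrite -subr_eq0 -eqn; apply/eqP; ring.
  by field.
rewrite /incident /= => /andP[/eqP e1 /eqP e2].
(* Membership in the span can be tested over [K], with the [c] that cancels the form [u]; incidence
   and the complex equation then cancel [w] and [n]. *)
rewrite /on_line /= -(map_submx iota); apply/sub_rVP.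
pose c := (form u q - form u a) / form u d; exists c.
have ed : form n d = form u d * form w a - form u a * form w d.
  by apply/eqP; rewrite -subr_eq0 -eqn; apply/eqP; ring.
have ew : form w q = form u q * (form w d / form u d) - (form w d / form u d * form u a - form w a).
  by rewrite -e1 addrK.
have en : form n q = form u a * (form w d / form u d * form u a - form w a) + form n a
    - form u q * (form w d / form u d * form u a - form w a).
  by rewrite -e2; ring.
apply/eqP; rewrite -subr_eq0; apply/eqP; apply: dot3_eq0; rewrite dot3_combine formB /c.
- by rewrite en ed; field.
- by field.
by rewrite ew; field.
Qed.

Lemma chart_line_inj l l' :
  form n l.2 + form u l.1 * form w l.2 - form u l.2 * form w l.1 = 0 ->
  form n l'.2 + form u l'.1 * form w l'.2 - form u l'.2 * form w l'.1 = 0 ->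
  form u l.2 != 0 -> form u l'.2 != 0 -> chart_line l = chart_line l' -> same_line l l'.
Proof. by move=> e e' d d' ll q; rewrite !chart_incident // ll. Qed.

Lemma chart_bound (Q : seq 'rV[F]_3) (L : seq ('rV[F]_3 * 'rV[F]_3)) :
  uniq Q -> uniq L -> {in L &, forall l l', same_line l l' -> l = l'} ->
  {in L, forall l, form n l.2 + form u l.1 * form w l.2 - form u l.2 * form w l.1 = 0} ->
  {in L, forall l, form u l.2 != 0} -> char_bound F (size L) ->
  exists J, (incidences Q L <= 1000 * size Q + 2 * size L + J)%N /\
    (J ^ 4 <= 1200 * size L ^ 2 * size Q ^ 3)%N.
Proof.
move=> uQ uL Linj eqnL uLd ch.
pose Q' := [seq chart_point q | q <- Q]; pose L' := [seq chart_line l | l <- L].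
have uQ' : uniq Q' by rewrite map_inj_uniq //; apply: chart_point_inj.
have uL' : uniq L'.
  rewrite map_inj_in_uniq // => l l' lL l'L e; apply: Linj => //.
  exact: chart_line_inj (eqnL _ lL) (eqnL _ l'L) (uLd _ lL) (uLd _ l'L) e.
case: (point_line_bound uQ' uL') => [q|J].
  by rewrite size_map => qK; apply: ch; rewrite -(fmorph_pchar iota).
rewrite !size_map => -[le J4]; exists J; split=> //.
apply: leq_trans le; rewrite /incidences /Q' big_map; apply: leq_sum => q _.
rewrite count_map -sum1_count [X in (_ <= X)%N]big_mkcond /= big_seq [X in (_ <= X)%N]big_seq.
apply: leq_sum => l lL; rewrite (chart_incident q (eqnL _ lL) (uLd _ lL)).
by case: (incident _ _).
Qed.

End Chart.

End Coordinates.

Lemma distinct_lines_uniq (F : fieldType) (L : seq ('rV[F]_3 * 'rV[F]_3)) :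
  distinct_lines L -> uniq L /\ {in L &, forall l l', same_line l l' -> l = l'}.
Proof.
move=> dL; split.
  apply/(uniqP (0, 0)) => i j; rewrite !inE => iL jL e; apply/eqP; apply: contraT => /eqP ij.
  by case: (dL i j iL jL ij) => q; rewrite e.
move=> l l' lL lL' ll; apply/eqP; apply: contraT => ne.
case: (dL (index l L) (index l' L)); rewrite ?index_mem ?nth_index //.
by move=> e; rewrite -(nth_index (0, 0) lL) e nth_index // eqxx in ne.
Qed.

Lemma incidences_bound (F : fieldType) (L : seq ('rV[F]_3 * 'rV[F]_3)) (Q : seq 'rV[F]_3) :
  uniq Q -> all (@is_line F) L -> distinct_lines L -> in_regular_complex L ->
  char_bound F (size L) ->
  exists J, (incidences Q L <= 2000 * size Q + 4 * size L + 2 * J)%N /\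
    (J ^ 4 <= 1200 * size L ^ 2 * size Q ^ 3)%N.
Proof.
move=> uQ aL /distinct_lines_uniq[uL Linj] [K [iota [n [m [nm eqL]]]]] ch.
have m0 : m != 0.
  by apply: contraNneq nm => ->; rewrite /dot3 big1 // => i _; rewrite mxE mulr0.
have [u [w uw]] := exists_cross m0; subst m.
have eqn l : l \in L -> form iota n l.2 + form iota u l.1 * form iota w l.2
    - form iota u l.2 * form iota w l.1 = 0.
  by move=> /eqL; rewrite complex_equation.
pose L1 := [seq l <- L | form iota u l.2 != 0]; pose L2 := [seq l <- L | ~~ (form iota u l.2 != 0)].
have sz (a : pred _) : (size [seq l <- L | a l] <= size L)%N by rewrite size_filter count_size.
have chs (a : pred _) : char_bound F (size [seq l <- L | a l]).
  by move=> p /ch; apply: leq_trans; rewrite leq_exp2r.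
have [J1 [le1 J14]] : exists J, (incidences Q L1 <= 1000 * size Q + 2 * size L1 + J)%N /\
    (J ^ 4 <= 1200 * size L1 ^ 2 * size Q ^ 3)%N.
  apply: (chart_bound (iota := iota) nm) => //; rewrite ?filter_uniq //.
  - by move=> l l'; rewrite !mem_filter => /andP[_ ?] /andP[_ ?]; apply: Linj.
  - move=> l; rewrite mem_filter => /andP[_ lL]. exact: eqn.
  - by move=> l; rewrite mem_filter => /andP[].
  exact: chs.
have formN v q : form iota (- v) q = - form iota v q by rewrite !formE !mxE; ring.
have nm' : dot3 n (cross w (- u)) != 0.
  suff -> : cross w (- u) = cross u w by [].
  by apply: row3P; rewrite !crossE !mxE; ring.
(* Lines with u.d = 0 are handled in the chart (w, -u, n): the equation of the complex
   prevents u.d and w.d from vanishing together. *)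
have [J2 [le2 J24]] : exists J, (incidences Q L2 <= 1000 * size Q + 2 * size L2 + J)%N /\
    (J ^ 4 <= 1200 * size L2 ^ 2 * size Q ^ 3)%N.
  apply: (chart_bound (iota := iota) nm') => //; rewrite ?filter_uniq //.
  - by move=> l l'; rewrite !mem_filter => /andP[_ ?] /andP[_ ?]; apply: Linj.
  - move=> l; rewrite mem_filter => /andP[_ /eqn] e.
    by rewrite !formN -[RHS]e; ring.
  - move=> l; rewrite mem_filter negbK => /andP[/eqP ud lL].
    apply: contraTneq (allP aL l lL) => wd; rewrite negbK.
    have nd : form iota n l.2 = 0 by have := eqn l lL; rewrite ud wd mulr0 mul0r subr0 addr0.
    have z v : form iota v 0 = 0 by rewrite formE !mxE rmorph0 !mulr0 !addr0.
    by apply/eqP/(forms_inj (iota := iota) nm); rewrite ?nd ?ud ?wd z.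
  exact: chs.
have split12 : incidences Q L = (incidences Q L1 + incidences Q L2)%N.
  rewrite /incidences -big_split /=; apply: eq_bigr => q _.
  by rewrite (bigID (fun l => form iota u l.2 != 0)) /= !big_filter.
exists (maxn J1 J2); split.
  rewrite split12; have := sz (fun l => form iota u l.2 != 0).
  have := sz (fun l => ~~ (form iota u l.2 != 0)); rewrite -/L1 -/L2.
  move: le1 le2; move: (incidences Q L1) (incidences Q L2) (size L1) (size L2) (size L) (size Q).
  clear; lia.
have bnd (a : pred _) J : (J ^ 4 <= 1200 * size [seq l <- L | a l] ^ 2 * size Q ^ 3)%N ->
    (J ^ 4 <= 1200 * size L ^ 2 * size Q ^ 3)%N.
  by move/leq_trans; apply; rewrite leq_mul2r leq_mul2l leq_exp2r // sz !orbT.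
by case: (leqP J1 J2) => _; [apply: bnd J24 | apply: bnd J14].
Qed.

(* Passage to real numbers *)
Delimit Scope R_scope with Re.

Lemma INR_leq (a b : nat) : (a <= b)%N -> (INR a <= INR b)%Re.
Proof. by move/leP/le_INR. Qed.

Lemma INR_addn (a b : nat) : INR (a + b)%N = (INR a + INR b)%Re.
Proof. exact: plus_INR. Qed.

Lemma INR_muln (a b : nat) : INR (a * b)%N = (INR a * INR b)%Re.
Proof. exact: mult_INR. Qed.

Lemma INR_expn (a k : nat) : INR (a ^ k)%N = (INR a ^ k)%Re.
Proof. by elim: k => // k IH; rewrite expnS INR_muln IH. Qed.

(** The fourth power of m^(3/4) n^(1/2) is n^2 m^3, and 1200 < 6^4 = 1296. *)
Lemma le_of_pow4_le (J m n : nat) :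
  (J ^ 4 <= 1200 * n ^ 2 * m ^ 3)%N ->
  (INR J <= 6 * (sqrt (sqrt (INR m ^ 3)) * sqrt (INR n)))%Re.
Proof.
move/INR_leq; rewrite (INR_muln (1200 * n ^ 2)) (INR_muln 1200) !INR_expn.
have -> : INR 1200 = 1200%Re by rewrite INR_IZR_INZ.
set y := (sqrt _ * sqrt _)%Re => le.
have m0 : (0 <= INR m ^ 3)%Re by apply: pow_le; apply: pos_INR.
have y0 : (0 <= y)%Re by apply: Rmult_le_pos; apply: sqrt_pos.
have y4 : (y ^ 4 = INR n ^ 2 * INR m ^ 3)%Re.
  rewrite /y Rpow_mult_distr (_ : 4%N = (2 * 2)%N) // !pow_mult !pow2_sqrt //.
  - by rewrite Rmult_comm.
  - exact: pos_INR.
  exact: sqrt_pos.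
have J0 := pos_INR J.
apply: Rnot_lt_le => lt.
have lt2 : ((6 * y) ^ 2 < INR J ^ 2)%Re by nra.
have lt4 : (((6 * y) ^ 2) ^ 2 < (INR J ^ 2) ^ 2)%Re.
  have : (0 <= (6 * y) ^ 2)%Re by apply: pow2_ge_0.
  nra.
have : (1296 * y ^ 4 < INR J ^ 4)%Re by move: lt4; rewrite -!pow_mult Rpow_mult_distr /=; lra.
have : (0 <= y ^ 4)%Re by apply: pow_le.
rewrite y4; lra.
Qed.

Lemma INR_leq_lin (c d e i a b j : nat) :
  (i <= c * a + d * b + e * j)%N ->
  (INR i <= INR c * INR a + INR d * INR b + INR e * INR j)%Re.
Proof. by move/INR_leq; rewrite !INR_addn !INR_muln. Qed.

Theorem mainTheorem1 :
  exists C : Reals.Rdefinitions.R,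
  forall (F : fieldType) (L : seq ('rV[F]_3 * 'rV[F]_3)) (Q : seq 'rV[F]_3),
    uniq Q ->
    all (@is_line F) L ->
    distinct_lines L ->
    in_regular_complex L ->
    char_bound F (size L) ->
    Reals.Rdefinitions.Rle (Reals.Raxioms.INR (incidences Q L))
      (Reals.Rdefinitions.Rmult C (inc_bound (size Q) (size L))).
Proof.
(* The largest coefficient: 2000 for points, 4 for lines, 2 * 6 = 12 for the main term. *)
exists 2000%Re => F L Q uQ aL dL cL ch.
have [J [/INR_leq_lin le /le_of_pow4_le J4]] := incidences_bound uQ aL dL cL ch.
move: le; rewrite /inc_bound.
have -> : INR 2000 = 2000%Re by rewrite INR_IZR_INZ.
have -> : INR 4 = 4%Re by rewrite INR_IZR_INZ.
have -> : INR 2 = 2%Re by rewrite INR_IZR_INZ.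
have := pos_INR (size L); have := pos_INR (size Q).
have : (0 <= sqrt (sqrt (INR (size Q) ^ 3)) * sqrt (INR (size L)))%Re.
  by apply: Rmult_le_pos; apply: sqrt_pos.
lra.
Qed.
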